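(* Let $G$ be a simple cubic claw-free matching covered graph that is not minimal matching covered. Then: (i) $b^{*}(G)\geq 1$ and $|RE(G)|=\sum_{i=1}^{b^{*}(G)} n_i$, where $n_1,\dots,n_{b^{*}(G)}$ are the numbers of vertices of the bricks of $G$ that are different from $K_4$ and $\overline{C_6}$; (ii) $|RE(G)|\geq 12$, and this bound is sharp: there exist simple cubic claw-free matching covered graphs that are not minimal matching covered and have exactly 12 removable edges.
   Context: A graph is matching covered if it is connected, has at least two vertices, and every edge lies in a perfect matching. An edge $e$ of a matching covered graph $G$ is removable if $G-e$ is matching covered; $RE(G)$ is the set of removable edges; $G$ is minimal matching covered if $RE(G)=\emptyset$. Claw-free: no induced $K_{1,3}$. $\overline{C_6}$ is the complement of the 6-cycle (triangular prism). For $X\subset V(G)$ nonempty proper, $\partial(X)$ is the set of edges with exactly one end in $X$; it is nontrivial if $|X|\ge2$ and $|V(G)\setminus X|\ge 2$. $G\{X\}$ denotes the graph obtained from $G$ by shrinking $V(G)\setminus X$ to a single vertex (keeping multiple edges); $G\{X\}$ and $G\{V(G)\setminus X\}$ are the two $\partial(X)$-contractions. A cut $C$ of a matching covered graph is tight if every perfect matching meets $C$ in exactly one edge. A matching covered graph with no nontrivial tight cut is a brace if bipartite and a brick otherwise. Repeatedly taking both contractions along nontrivial tight cuts (both contractions are matching covered) until none remain yields a list of bricks and braces (the tight cut decomposition); this list is independent of the choices made, up to multiple edges. $b^*(G)$ is the number of bricks in this list that are different from $K_4$ and $\overline{C_6}$. *)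

(* Defs.v *)
From mathcomp Require Import all_boot.

Set Implicit Arguments.
Unset Strict Implicit.
Unset Printing Implicit Defensive.

(* Finite loopless multigraphs: parallel edges are distinct edges with the same
   set of ends. *)
Record mgraph : Type := MGraph {
  vertex : finType;
  edge : finType;
  ends : edge -> {set vertex};
  ends_card2 : forall e, #|ends e| == 2 }.

Arguments ends {m} e.

Section Basics.
Variable G : mgraph.
Implicit Types (u v : vertex G) (e : edge G) (M : {set edge G}).

Definition adj u v : bool := [exists e, ends e == [set u; v]].

Definition connected : bool := [forall u, forall v, connect adj u v].

Definition simple : bool := injectiveb (@ends G).

Definition incident v : {set edge G} := [set e | v \in ends e].

Definition cubic : bool := [forall v, #|incident v| == 3].

Definition perfect_matching M : bool := [forall v, #|M :&: incident v| == 1].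

Definition matching_covered : bool :=
  [&& connected, 1 < #|vertex G|
    & [forall e, [exists M, perfect_matching M && (e \in M)]]].

Definition bipartite : bool :=
  [exists A : {set vertex G}, [forall e, #|ends e :&: A| == 1]].

(* Adjacency ignores multiplicities, so the next two notions refer to the
   underlying simple graph of G; r is a simple graph on {0, ..., n-1}. *)
Definition has_induced n (r : rel 'I_n) : bool :=
  [exists f : {ffun 'I_n -> vertex G},
     injectiveb f && [forall i, forall j, adj (f i) (f j) == r i j]].

Definition underlying_iso n (r : rel 'I_n) : bool :=
  (#|vertex G| == n) && has_induced r.

End Basics.

Definition K13 : rel 'I_4 := fun i j => (i == ord0) (+) (j == ord0).

Definition K4 : rel 'I_4 := fun i j => i != j.

Definition C6 : rel 'I_6 :=
  fun i j => (j == i.+1 %% 6 :> nat) || (i == j.+1 %% 6 :> nat).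

Definition C6bar : rel 'I_6 := fun i j => (i != j) && ~~ C6 i j.

Definition claw_free (G : mgraph) : bool := ~~ has_induced G K13.

Section Delete.
Variables (G : mgraph) (e : edge G).

Definition delete_edge_ends (f : {f : edge G | f != e}) : {set vertex G} :=
  ends (val f).

Lemma delete_edge_card2 f : #|delete_edge_ends f| == 2.
Proof. exact: ends_card2. Qed.

Definition delete_edge : mgraph := MGraph delete_edge_card2.

End Delete.

Definition removable (G : mgraph) (e : edge G) : bool :=
  matching_covered (delete_edge e).

Definition RE (G : mgraph) : {set edge G} := [set e | removable e].

Definition minimal_matching_covered (G : mgraph) : bool :=
  matching_covered G && (RE G == set0).

Section Cuts.
Variable G : mgraph.
Implicit Types X : {set vertex G}.

Definition cut X : {set edge G} := [set e | #|ends e :&: X| == 1].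

Definition nontrivial X : bool := (1 < #|X|) && (1 < #|~: X|).

Definition tight X : bool :=
  [forall M : {set edge G}, perfect_matching M ==> (#|M :&: cut X| == 1)].

Definition has_nontrivial_tight_cut : bool :=
  [exists X, nontrivial X && tight X].

Definition brace : bool :=
  [&& matching_covered G, ~~ has_nontrivial_tight_cut & bipartite G].

Definition brick : bool :=
  [&& matching_covered G, ~~ has_nontrivial_tight_cut & ~~ bipartite G].

End Cuts.

(* G{X}: the vertex None is the one to which the complement of X is shrunk;
   edges with both ends outside X (which would become loops) disappear. *)
Section Shrink.
Variables (G : mgraph) (X : {set vertex G}).

Definition shrink_vertex (v : vertex G) : option {x : vertex G | x \in X} :=
  insub v.

Definition shrink_ends (e : {e : edge G | ends e :&: X != set0}) :
    {set option {x : vertex G | x \in X}} :=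
  [set shrink_vertex v | v in ends (val e)].

Lemma shrink_card2 e : #|shrink_ends e| == 2.
Proof.
case: e => e eX; rewrite /shrink_ends /=.
rewrite card_in_imset; first exact: ends_card2.
have /cards2P[u [v [uv eE]]] := ends_card2 e.
have inX a b : insub a = insub b :> option {x : vertex G | x \in X} ->
    (a \in X) || (b \in X) -> a = b.
  rewrite /=; case: insubP => [a' _ <- | /negPf->]; case: insubP => //.
  - by move=> b' _ <- [->].
  - by move=> /negPf->.
have uvX : (u \in X) || (v \in X).
  case/set0Pn: eX => w; rewrite eE !inE => /andP[/orP[]/eqP-> ->] //.
  by rewrite orbT.
move=> a b; rewrite eE !inE => /orP[]/eqP-> /orP[]/eqP-> // /inX; apply=> //.
by rewrite orbC.
Qed.

Definition shrink : mgraph := MGraph shrink_card2.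

End Shrink.

(* Ds is the list of bricks and braces of some run of the decomposition, with
   arbitrary choices of the nontrivial tight cuts. *)
Inductive tight_cut_decomposition : mgraph -> seq mgraph -> Prop :=
| TCD_leaf G : brick G || brace G -> tight_cut_decomposition G [:: G]
| TCD_cut G (X : {set vertex G}) Ds1 Ds2 :
    nontrivial X -> tight X ->
    tight_cut_decomposition (shrink X) Ds1 ->
    tight_cut_decomposition (shrink (~: X)) Ds2 ->
    tight_cut_decomposition G (Ds1 ++ Ds2).

(* The decomposition is unique only up to multiple edges, so "different from
   K_4 and the complement of C_6" is also understood up to multiple edges. *)
Definition star_brick (B : mgraph) : bool :=
  [&& brick B, ~~ underlying_iso B K4 & ~~ underlying_iso B C6bar].

Definition star_bricks (Ds : seq mgraph) : seq mgraph :=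
  [seq B <- Ds | star_brick B].

Definition bstar (Ds : seq mgraph) : nat := size (star_bricks Ds).

(* Main.v *)
Require Import Defs.
From mathcomp Require Import all_boot all_algebra.

Set Implicit Arguments.
Unset Strict Implicit.
Unset Printing Implicit Defensive.

(* Let M0 consist of the edges lying in no triangle together with the central
   edges of the diamonds. M0 is a perfect matching, and its complement F is a
   2-factor into triangles and 4-cycles with a chord in M0. The sets M0 \ M, for
   M a perfect matching, form a vector space over F_2 (in the graph with the
   triangles shrunk they are the cycle space). Hence, if C is tight and
   C meets M0 in f, then the M0-edge at a vertex whose two F-edges lie in C is
   missed by exactly the perfect matchings missing f, so C consists of f and of
   the two F-edges at a single vertex. Consequently both contractions along C
   are again cubic, with F having short cycles (now also of length 2), and the
   number of removable edges lying in F-triangles is additive along C. In the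
   original graph these are all the removable edges. In a brick other than K_4
   all cycles of F are triangles, and since there are no cuts with two edges,
   two M0-edges are distinguished by some perfect matching (the cycle space is
   the orthogonal of the cut space); this makes all |V| edges of F removable,
   unless two triangles are joined by two M0-edges, which forces the prism. *)

(** Simplicity and claw-freeness do not survive a contraction, so the induction runs on cubic
    matching covered multigraphs with a fixed perfect matching [M0] whose complement F splits into
    digons, triangles and chorded 4-cycles. These short cycles are what makes the sets M0 \ M closed
    under symmetric difference: on a chordless 5-cycle, {1, 2} and {2, 3} can be matched along the
    cycle, but {1, 3} cannot. Removability is replaced by [solid], which counts triangle edges only:
    each edge of a digon can be exchanged for its parallel, so a digon created by a contraction
    would let the F-edges of a tight cut be counted on both sides. The constant 12 arises because a
    brick whose F consists of triangles has an order that is even and divisible by three, and order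
    six gives the prism. Sharpness needs no census of edges: at most |F| = |V| edges are removable,
    so on twelve vertices one removable edge forces exactly twelve. *)

(** * Cuts and perfect matchings *)

Section Basics.
Variable G : mgraph.
Implicit Types (u v x y : vertex G) (e f : edge G) (M : {set edge G}).
Implicit Types X Y : {set vertex G}.

Lemma endsP e v : v \in ends e -> exists2 p, v != p & ends e = [set v; p].
Proof.
have /cards2P[x [y [xy ->]]] := ends_card2 e.
rewrite !inE => /orP[]/eqP->; first by exists y.
by exists x; rewrite 1?eq_sym // setUC.
Qed.

Lemma ends_neq e x y : ends e = [set x; y] -> x != y.
Proof. by move=> E; have := ends_card2 e; rewrite E cards2; case: (x != y). Qed.

Lemma ends2 e : exists x y, ends e = [set x; y].
Proof. by have /cards2P[x [y [_ ->]]] := ends_card2 e; exists x, y. Qed.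

(** The exclusive or turns later facts about cuts into Boolean case analysis on which vertices lie
    in [X]. *)
Lemma mem_cut X e x y :
  ends e = [set x; y] -> (e \in cut X) = ((x \in X) (+) (y \in X)).
Proof.
move=> E; have xy := ends_neq E; rewrite inE E.
rewrite -sum1_card (eq_bigl (fun z => (z \in [set x; y]) && (z \in X))) => [|z].
  rewrite big_mkcondr /= big_setU1 ?inE // big_set1.
  by case: (x \in X); case: (y \in X).
by rewrite inE.
Qed.

Lemma cutC X : cut (~: X) = cut X.
Proof.
apply/setP=> e; have [x [y E]] := ends2 e.
by rewrite !(mem_cut _ E) !inE; case: (x \in X); case: (y \in X).
Qed.

Lemma tightC X : tight (~: X) = tight X.
Proof. by rewrite /tight cutC. Qed.

Lemma nontrivialC X : nontrivial (~: X) = nontrivial X.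
Proof. by rewrite /nontrivial setCK andbC. Qed.

Lemma cut_set1 v : cut [set v] = incident v.
Proof.
apply/setP=> e; have [x [y E]] := ends2 e.
have := ends_neq E; rewrite (mem_cut _ E) !inE E !inE eq_sym !(eq_sym v).
by case: (eqVneq x v) => [->|] //; case: (eqVneq y v) => [->|].
Qed.

Lemma pm_uniq M v e f : perfect_matching M -> e \in M -> f \in M ->
  v \in ends e -> v \in ends f -> e = f.
Proof.
move=> /forallP/(_ v)/cards1P[a aE] eM fM ve vf.
have: e \in M :&: incident v by rewrite !inE eM.
have: f \in M :&: incident v by rewrite !inE fM.
by rewrite aE !inE => /eqP-> /eqP->.
Qed.

Lemma pm_cover M v : perfect_matching M -> exists2 e, e \in M & v \in ends e.
Proof.
move=> /forallP/(_ v)/cards1P[a aE].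
have: a \in M :&: incident v by rewrite aE set11.
by rewrite !inE => /andP[aM va]; exists a.
Qed.

(** Each vertex of [X] is counted at the edge of [M] covering it; an edge of [M] contributes 1 if it
    is in the cut and 0 or 2 otherwise. *)
Lemma pm_parity M X :
  perfect_matching M -> odd #|M :&: cut X| = odd #|X|.
Proof.
move=> /forallP pm.
have -> : #|X| = \sum_(e in M) #|ends e :&: X|.
  rewrite -sum1_card (eq_bigr (fun v => \sum_(e in M | v \in ends e) 1)); last first.
    move=> v _; transitivity #|M :&: incident v|; first by rewrite (eqP (pm v)).
    by rewrite -sum1_card; apply: eq_bigl => e; rewrite !inE.
  rewrite (exchange_big_dep (mem M)) /=; last by move=> ? ? _ /andP[].
  apply: eq_bigr => e eM; rewrite -sum1_card; apply: eq_bigl => v.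
  by rewrite !inE eM andbC.
have -> : #|M :&: cut X| = \sum_(e in M) (e \in cut X).
  by rewrite -sum1_card -big_mkcondr; apply: eq_bigl => e; rewrite inE.
have sumodd (F H : edge G -> nat) : (forall e, odd (F e) = odd (H e)) ->
    odd (\sum_(e in M) F e) = odd (\sum_(e in M) H e).
  by move=> FH; elim/big_rec2: _ => // e m n _; rewrite !oddD FH => ->.
apply: sumodd => e; rewrite inE oddb.
have: #|ends e :&: X| <= 2 by rewrite -(eqP (ends_card2 e)) subset_leq_card ?subsetIl.
by case: #|_| => [|[|[|]]].
Qed.

Hypothesis mcG : matching_covered G.

Lemma mc_edge e : exists2 M, perfect_matching M & e \in M.
Proof.
by case/and3P: mcG => _ _ /forallP/(_ e)/existsP[M /andP[? ?]]; exists M.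
Qed.

Lemma mc_cut X : X != set0 -> X != setT -> cut X != set0.
Proof.
case/and3P: mcG => /forallP con _ _ /set0Pn[x xX] XT.
have /subsetPn[y _ yX] : ~~ ([set: vertex G] \subset X) by rewrite subTset.
have /connectP[p] := forallP (con x) y.
elim: p x xX => [|z p IH] x xX /=; first by move=> _ e; rewrite e xX in yX.
case/andP=> /existsP[e /eqP ee] pth yE.
case: (boolP (z \in X)) => zX; first exact: IH zX pth yE.
by apply/set0Pn; exists e; rewrite (mem_cut _ ee) xX (negPf zX).
Qed.

Hypothesis cubG : cubic G.

Lemma incident3 v : #|incident v| = 3.
Proof. exact/eqP/(forallP cubG). Qed.

Lemma pm_avoid e : exists2 M, perfect_matching M & e \notin M.
Proof.
have [x [y E]] := ends2 e; have xe : x \in ends e by rewrite E !inE eqxx.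
have /card_gt1P[a [b [ax bx ab]]] : 1 < #|incident x| by rewrite incident3.
have [f fx fe] : exists2 f, f \in incident x & f != e.
  by case: (eqVneq a e) => [<-|]; [exists b; rewrite 1?eq_sym | exists a].
have [M pM fM] := mc_edge f; exists M => //; apply: contra fe => eM.
by rewrite (pm_uniq pM fM eM _ xe) //; rewrite inE in fx.
Qed.

(** By parity all perfect matchings meet a cut equally modulo 2, whereas one of them contains [e]
    and another, through a second edge at an end of [e], avoids it. *)
Lemma not_bridge X e : cut X != [set e].
Proof.
apply/eqP=> C; have [M pM eM] := mc_edge e; have [N pN eN] := pm_avoid e.
have := pm_parity X pM; rewrite -(pm_parity X pN) C.
have ->: M :&: [set e] = [set e] by apply/setIidPr; rewrite sub1set.
have ->: N :&: [set e] = set0 by apply/eqP; rewrite setI_eq0 disjoint_sym disjoints1.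
by rewrite cards1 cards0.
Qed.

End Basics.

(* [M0] splits the graph into a 2-factor [F = E \ M0]; a block is the cycle of
   [F] through [v], and it has at most four vertices. *)
Inductive block (G : mgraph) (M0 : {set edge G}) v c1 c2 : Prop :=
| Digon p of ends c1 = [set v; p] & ends c2 = [set v; p]
| Triangle p q c3 of p != q & c3 \notin M0 & ends c1 = [set v; p]
    & ends c2 = [set v; q] & ends c3 = [set p; q]
| Quad p q w c3 c4 h of p != q & v != w & c3 \notin M0 & c4 \notin M0
    & h \in M0 & ends c1 = [set v; p] & ends c2 = [set v; q]
    & ends c3 = [set p; w] & ends c4 = [set q; w]
    & ends h = [set v; w] \/ ends h = [set p; q].

Record block_graph (G : mgraph) (M0 : {set edge G}) : Prop := BlockGraph {
  bg_mc : matching_covered G;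
  bg_cubic : cubic G;
  bg_pm : perfect_matching M0;
  bg_block : forall v c1 c2, c1 != c2 -> c1 \notin M0 -> c2 \notin M0 ->
    v \in ends c1 -> v \in ends c2 -> block M0 v c1 c2 }.

(** * Perfect matchings relative to the 2-factor F *)

Section BlockGraph.
Variables (G : mgraph) (M0 : {set edge G}) (bg : block_graph M0).
Implicit Types (u v x y : vertex G) (e f : edge G) (M : {set edge G}).
Implicit Types X Y : {set vertex G}.

Let mcG := bg_mc bg.
Let cubG := bg_cubic bg.
Let pm0 := bg_pm bg.

(** The edge is taken rather than its other end: matchings are tested on it, and for distinct [x],
    [y] the equation [mate x = mate y] records that an [M0]-edge joins them. *)
Definition mate v : edge G := s2val (sig2W (pm_cover v pm0)).

Lemma mate_in v : mate v \in M0.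
Proof. by rewrite /mate; case: sig2W. Qed.

Lemma mate_end v : v \in ends (mate v).
Proof. by rewrite /mate; case: sig2W. Qed.

Lemma mate_uniq v e : e \in M0 -> v \in ends e -> mate v = e.
Proof. by move=> eM ve; apply: pm_uniq pm0 (mate_in v) eM (mate_end v) ve. Qed.

Lemma star v c1 c2 : c1 != c2 -> c1 \notin M0 -> c2 \notin M0 ->
  v \in ends c1 -> v \in ends c2 -> incident v = [set mate v; c1; c2].
Proof.
move=> c12 c1M c2M vc1 vc2; apply/esym/eqP; rewrite eqEcard incident3 //.
apply/andP; split.
  by apply/subsetP=> e; rewrite !inE -orbA => /or3P[]/eqP->; rewrite ?mate_end.
rewrite -setUA cardsU1 cards2 c12 !inE negb_or.
by rewrite (memPn c1M) ?mate_in // (memPn c2M) ?mate_in.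
Qed.

Lemma star_card A v c1 c2 : c1 != c2 -> c1 \notin M0 -> c2 \notin M0 ->
  v \in ends c1 -> v \in ends c2 ->
  #|A :&: incident v| = (mate v \in A) + (c1 \in A) + (c2 \in A).
Proof.
move=> c12 c1M c2M vc1 vc2.
set s := (X in _ = X); rewrite -sum1_card.
rewrite (eq_bigl (fun e => (e \in incident v) && (e \in A))) => [|e]; last first.
  by rewrite inE andbC.
rewrite big_mkcondr (star c12) // -setUA big_setU1 ?big_setU1 ?big_set1 ?inE //.
  by rewrite /s -addnA; do 3!case: (_ \in A).
by rewrite negb_or !(memPn _ _ (mate_in v)).
Qed.

(** At a vertex a perfect matching is described by three Booleans with sum 1; the local arguments
    below are truth tables over such equations. *)
Lemma star_pm M v c1 c2 : perfect_matching M ->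
  c1 != c2 -> c1 \notin M0 -> c2 \notin M0 ->
  v \in ends c1 -> v \in ends c2 ->
  (mate v \in M) + (c1 \in M) + (c2 \in M) = 1.
Proof.
by move=> /forallP/(_ v)/eqP pM *; rewrite -pM -star_card.
Qed.

Lemma F_other v c : c \notin M0 -> v \in ends c ->
  exists c', [/\ c != c', c' \notin M0 & v \in ends c'].
Proof.
move=> cM vc.
have mc : mate v != c by apply: contraNneq cM => <-; apply: mate_in.
have: 0 < #|incident v :\: [set mate v; c]|.
  by rewrite cardsDS ?incident3 ?cards2 ?mc //; apply/subsetP=> e;
    rewrite !inE => /orP[]/eqP->; rewrite ?mate_end.
case/card_gt0P=> c'; rewrite !inE negb_or -andbA => /and3P[c'm c'c vc'].
exists c'; split=> //; first by rewrite eq_sym.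
by apply: contra c'm => c'M; rewrite (mate_uniq c'M).
Qed.

Lemma F_pair v : exists c1 c2,
  [/\ c1 != c2, c1 \notin M0, c2 \notin M0, v \in ends c1 & v \in ends c2].
Proof.
have: 0 < #|incident v :\: [set mate v]|.
  by rewrite cardsDS ?incident3 ?cards1 //; rewrite sub1set inE mate_end.
case/card_gt0P=> c; rewrite !inE => /andP[cm vc].
have cM : c \notin M0 by apply: contra cm => cM; rewrite (mate_uniq cM).
by have [c' [? ? ?]] := F_other cM vc; exists c, c'.
Qed.

Lemma end1 e x y : ends e = [set x; y] -> x \in ends e.
Proof. by move->; rewrite set21. Qed.

Lemma end2 e x y : ends e = [set x; y] -> y \in ends e.
Proof. by move->; rewrite set22. Qed.

Lemma ends_inj v p q e : ends e = [set v; p] -> ends e = [set v; q] -> p = q.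
Proof.
move=> E E'; have := ends_neq E; have: p \in ends e := end2 E.
by rewrite E' !inE => /orP[]/eqP-> //; rewrite eqxx.
Qed.

Lemma edges_neq v p q c1 c2 :
  ends c1 = [set v; p] -> ends c2 = [set v; q] -> p != q -> c1 != c2.
Proof. by move=> E1 E2; apply: contraNneq => c; apply/eqP/(ends_inj E1); rewrite c. Qed.

Lemma star_pm2 M v p q c1 c2 : perfect_matching M -> p != q ->
  c1 \notin M0 -> c2 \notin M0 -> ends c1 = [set v; p] -> ends c2 = [set v; q] ->
  (mate v \in M) + (c1 \in M) + (c2 \in M) = 1.
Proof.
move=> pM pq c1M c2M E1 E2; apply: star_pm => //.
- exact: edges_neq E1 E2 pq.
- exact: end1 E1.
- exact: end1 E2.
Qed.

Lemma allE e x y (P : pred (vertex G)) : ends e = [set x; y] ->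
  [forall z in ends e, P z] = P x && P y.
Proof.
move=> E; apply/forall_inP/andP=> [H|[Px Py] z].
  by split; apply: H; rewrite E ?set21 ?set22.
by rewrite E !inE => /orP[]/eqP->.
Qed.

(* M0 :\: M is the symmetric difference of M0 :\: M1 and M0 :\: M2. On a triangle
   of F its completion to a matching is unique; on a longer cycle or a digon there
   are two completions, and [M] copies the one used by M1 or M2. *)
Lemma pm_sum M1 M2 : perfect_matching M1 -> perfect_matching M2 ->
  exists2 M, perfect_matching M &
    forall f, f \in M0 -> (f \in M) = ((f \in M1) == (f \in M2)).
Proof.
move=> pM1 pM2.
pose z x := (mate x \in M1) (+) (mate x \in M2).
(* [z x] means that [x] has to be matched inside F. The disjunct on mates serves a triangle edge
   with one end matched inside F by [M1] only and the other by [M2] only: neither matching contains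
   that edge, but the sum needs it. On digons and 4-cycles it never applies, since there all
   vertices are matched inside F together or not at all. *)
pose M := [set e | if e \in M0 then (e \in M1) == (e \in M2) else
  [forall x in ends e, z x] && [|| e \in M1, e \in M2
    | ~~ [forall x in ends e, mate x \in M1] &&
      ~~ [forall x in ends e, mate x \notin M1]]].
have inM f : f \in M0 -> (f \in M) = ((f \in M1) == (f \in M2)).
  by move=> fM; rewrite inE fM.
have inM' e x y : e \notin M0 -> ends e = [set x; y] ->
    (e \in M) = [&& z x, z y & [|| e \in M1, e \in M2
      | (mate x \in M1) (+) (mate y \in M1)]].
  move=> eM E; rewrite inE (negPf eM) !(allE _ E) /=.
  by case: (z x); case: (z y) => //=; do 2!case: (mate _ \in M1).
exists M => //; apply/forallP=> v; apply/eqP.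
have [c1 [c2 [c12 c1M c2M vc1 vc2]]] := F_pair v.
rewrite (star_card _ c12) // inM ?mate_in //.
have [p E1 E2|p q c3 pq c3M E1 E2 E3|p q w c3 c4 h pq vw c3M c4M hM E1 E2 E3 E4 H] :=
    bg_block bg c12 c1M c2M vc1 vc2.
- rewrite (inM' _ _ _ c1M E1) (inM' _ _ _ c2M E2) /z.
  have [pc1 pc2] := (end2 E1, end2 E2).
  move: (star_pm pM1 c12 c1M c2M vc1 vc2) (star_pm pM2 c12 c1M c2M vc1 vc2).
  move: (star_pm pM1 c12 c1M c2M pc1 pc2) (star_pm pM2 c12 c1M c2M pc1 pc2).
  do 2!case: (mate v \in _); do 2!case: (mate p \in _) => //;
  by do 2!case: (c1 \in _); do 2!case: (c2 \in _).
- rewrite (inM' _ _ _ c1M E1) (inM' _ _ _ c2M E2) /z.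
  have [vp vq] := (ends_neq E1, ends_neq E2).
  have E1' : ends c1 = [set p; v] by rewrite setUC.
  have E2' : ends c2 = [set q; v] by rewrite setUC.
  have E3' : ends c3 = [set q; p] by rewrite setUC.
  move: (star_pm2 pM1 pq c1M c2M E1 E2) (star_pm2 pM2 pq c1M c2M E1 E2).
  move: (star_pm2 pM1 vq c1M c3M E1' E3) (star_pm2 pM2 vq c1M c3M E1' E3).
  move: (star_pm2 pM1 vp c2M c3M E2' E3') (star_pm2 pM2 vp c2M c3M E2' E3').
  by do 2!case: (mate v \in _); do 2!case: (c1 \in _) => //;
    do 2!case: (c2 \in _) => //; do 2!case: (mate p \in _) => //;
    do 2!case: (c3 \in _) => //; do 2!case: (mate q \in _).
- rewrite (inM' _ _ _ c1M E1) (inM' _ _ _ c2M E2) /z.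
  have [vp vq] := (ends_neq E1, ends_neq E2).
  have [pw qw] := (ends_neq E3, ends_neq E4).
  have E1' : ends c1 = [set p; v] by rewrite setUC.
  have E2' : ends c2 = [set q; v] by rewrite setUC.
  have E3' : ends c3 = [set w; p] by rewrite setUC.
  have E4' : ends c4 = [set w; q] by rewrite setUC.
  have HH : mate v = mate w \/ mate p = mate q.
    case: H => E; [left|right].
      by rewrite (mate_uniq hM (end1 E)) (mate_uniq hM (end2 E)).
    by rewrite (mate_uniq hM (end1 E)) (mate_uniq hM (end2 E)).
  move: (star_pm2 pM1 pq c1M c2M E1 E2) (star_pm2 pM2 pq c1M c2M E1 E2).
  move: (star_pm2 pM1 vw c1M c3M E1' E3) (star_pm2 pM2 vw c1M c3M E1' E3).
  move: (star_pm2 pM1 vw c2M c4M E2' E4) (star_pm2 pM2 vw c2M c4M E2' E4).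
  move: (star_pm2 pM1 pq c3M c4M E3' E4') (star_pm2 pM2 pq c3M c4M E3' E4').
  by case: HH => ->; do 2!case: (mate w \in _); do 2!case: (c1 \in _) => //;
    do 2!case: (c2 \in _) => //; do 2!case: (mate q \in _) => //;
    do 2!case: (c3 \in _) => //; do 2!case: (c4 \in _) => //;
    do 2!case: (mate _ \in _).
Qed.

End BlockGraph.

(** * Tight cuts of block graphs *)

Section TightCuts.
Variables (G : mgraph) (M0 : {set edge G}) (bg : block_graph M0).
Implicit Types (u v x y : vertex G) (e f : edge G) (M : {set edge G}).
Implicit Types X Y : {set vertex G}.

Let mcG := bg_mc bg.
Let cubG := bg_cubic bg.
Let pm0 := bg_pm bg.

(** If [M] uses the chord, then none of the four cycle edges is in [M], as each meets the chord.
    Otherwise the two ends of the chord are matched to the other two vertices by opposite edges. *)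
Lemma quad_pm v p q w c1 c2 c3 c4 h M : perfect_matching M ->
  p != q -> v != w -> c1 \notin M0 -> c2 \notin M0 -> c3 \notin M0 ->
  c4 \notin M0 -> h \in M0 -> ends c1 = [set v; p] -> ends c2 = [set v; q] ->
  ends c3 = [set p; w] -> ends c4 = [set q; w] ->
  ends h = [set v; w] \/ ends h = [set p; q] ->
  (c1 \in M) = (c4 \in M).
Proof.
move=> pM pq vw c1M c2M c3M c4M hM E1 E2 E3 E4 H.
have E1' : ends c1 = [set p; v] by rewrite setUC.
have E2' : ends c2 = [set q; v] by rewrite setUC.
have E3' : ends c3 = [set w; p] by rewrite setUC.
have E4' : ends c4 = [set w; q] by rewrite setUC.
have HH : mate bg v = mate bg w \/ mate bg p = mate bg q.
  case: H => E; [left|right];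
  by rewrite (mate_uniq bg hM (end1 E)) (mate_uniq bg hM (end2 E)).
move: (star_pm2 bg pM pq c1M c2M E1 E2) (star_pm2 bg pM vw c1M c3M E1' E3).
move: (star_pm2 bg pM vw c2M c4M E2' E4) (star_pm2 bg pM pq c3M c4M E3' E4').
by case: HH => ->; do 3!case: (mate _ _ \in _) => //=; case: (c1 \in _) => //;
  case: (c2 \in _) => //; case: (c3 \in _); case: (c4 \in _).
Qed.

Variable X : {set vertex G}.
Hypothesis tX : tight X.

Lemma tight_card M : perfect_matching M -> #|M :&: cut X| = 1.
Proof. by move=> pM; move/forallP/(_ M)/implyP/(_ pM)/eqP: tX. Qed.

Lemma tight_uniq M e f : perfect_matching M -> e \in M -> f \in M ->
  e \in cut X -> f \in cut X -> e = f.
Proof.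
move=> /tight_card/eqP/cards1P[a aE] eM fM eC fC.
have: e \in M :&: cut X by rewrite inE eM.
have: f \in M :&: cut X by rewrite inE fM.
by rewrite aE !inE => /eqP-> /eqP->.
Qed.

(** Some perfect matching contains both of these opposite edges, which tightness forbids. *)
Lemma quad_cut v p q w c1 c2 c3 c4 h :
  p != q -> v != w -> c1 \notin M0 -> c2 \notin M0 -> c3 \notin M0 ->
  c4 \notin M0 -> h \in M0 -> ends c1 = [set v; p] -> ends c2 = [set v; q] ->
  ends c3 = [set p; w] -> ends c4 = [set q; w] ->
  ends h = [set v; w] \/ ends h = [set p; q] ->
  c1 \in cut X -> c4 \in cut X -> False.
Proof.
move=> pq vw c1M c2M c3M c4M hM E1 E2 E3 E4 H C1 C4.
have [M pM c1inM] := mc_edge mcG c1.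
have := c1inM; rewrite (quad_pm pM pq vw c1M c2M c3M c4M hM E1 E2 E3 E4 H).
move=> c4inM; have c14 := tight_uniq pM c1inM c4inM C1 C4.
have := end1 E1; rewrite c14 E4 !inE (negPf vw) orbF => /eqP vq.
by have := ends_neq E2; rewrite vq eqxx.
Qed.

(** A cycle crosses the cut an even number of times. Two edges of a digon or of a triangle share a
    vertex, and on a 4-cycle [quad_cut] rules out opposite edges. *)
Lemma cut_F_pair c : c \notin M0 -> c \in cut X -> exists v c1 c2,
  [/\ c1 != c2, c1 \notin M0, c2 \notin M0, v \in ends c1 & v \in ends c2] /\
  c1 \in cut X /\ c2 \in cut X.
Proof.
move=> cM cC; have [v vc] : exists v, v \in ends c.
  by have [v [p E]] := ends2 c; exists v; apply: end1 E.
have [c' [cc' c'M vc']] := F_other bg cM vc.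
have [p E1 E2|p q c3 pq c3M E1 E2 E3|p q w c3 c4 h pq vw c3M c4M hM E1 E2 E3 E4 H] :=
    bg_block bg cc' cM c'M vc vc'.
- exists v, c, c'; split=> //; split=> //.
  by move: cC; rewrite (mem_cut _ E1) (mem_cut _ E2).
- have := cC; rewrite (mem_cut _ E1) => vp.
  case vq: ((v \in X) (+) (q \in X)).
    by exists v, c, c'; split=> //; rewrite (mem_cut _ E2).
  exists p, c, c3; split; last first.
    rewrite cC (mem_cut _ E3); split=> //.
    by move: vp vq; case: (v \in X); case: (p \in X); case: (q \in X).
  split=> //; [|exact: end2 E1|exact: end1 E3].
  apply: contraNneq pq => cc3; have := end1 E1.
  rewrite cc3 E3 !inE => /orP[]/eqP vE.
    by have := ends_neq E1; rewrite vE eqxx.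
  by have := ends_neq E2; rewrite vE eqxx.
- have := cC; rewrite (mem_cut _ E1) => vp.
  case vq: ((v \in X) (+) (q \in X)).
    by exists v, c, c'; split=> //; rewrite (mem_cut _ E2).
  have c4C : c4 \notin cut X.
    by apply/negP; apply: quad_cut E1 E2 E3 E4 H cC.
  exists p, c, c3; split; last first.
    move: c4C; rewrite cC (mem_cut _ E3) (mem_cut _ E4); split=> //.
    by move: vp vq c4C; case: (v \in X); case: (p \in X); case: (q \in X);
      case: (w \in X).
  split=> //; [|exact: end2 E1|exact: end1 E3].
  have E1' : ends c = [set p; v] by rewrite setUC.
  exact: edges_neq E1' E3 vw.
Qed.

Lemma tight_cut_struct : exists v c1 c2 f,
  [/\ c1 != c2, c1 \notin M0, c2 \notin M0, v \in ends c1 & v \in ends c2] /\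
  f \in M0 /\ cut X = [set f; c1; c2].
Proof.
have /cards1P[f fE] : #|M0 :&: cut X| == 1 by rewrite tight_card.
have /setIP[fM fC] : f \in M0 :&: cut X by rewrite fE set11.
have [c cM cC] : exists2 c, c \notin M0 & c \in cut X.
  have : ~~ (cut X \subset [set f]).
    apply: contra (not_bridge mcG cubG X f) => sub.
    by rewrite eqEsubset sub sub1set.
  case/subsetPn=> c cC cf; exists c => //; apply: contra cf => cM.
  by rewrite -fE inE cM.
have [v [c1 [c2 [[c12 c1M c2M vc1 vc2] [C1 C2]]]]] := cut_F_pair cM cC.
exists v, c1, c2, f; do 2!split=> //.
(* If [mate v] is missed, then [c1] or [c2] is the one cut edge of [M]. *)
have fout M : perfect_matching M -> mate bg v \notin M -> f \notin M.
  move=> pM rM; apply/negP=> fM'; move: (star_pm bg pM c12 c1M c2M vc1 vc2).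
  rewrite (negPf rM); case: (boolP (c1 \in M)) => [c1'|_].
    by move: c1M; rewrite (tight_uniq pM c1' fM' C1 fC) fM.
  case: (boolP (c2 \in M)) => // c2'.
  by move: c2M; rewrite (tight_uniq pM c2' fM' C2 fC) fM.
have [N pN rN] := pm_avoid mcG cubG (mate bg v).
(* If [M] missed [f] but contained [mate v], its sum with [N], which misses both, would miss
   [mate v] and contain [f], against [fout]. *)
have rout M : perfect_matching M -> f \notin M -> mate bg v \notin M.
  move=> pM f'; apply/negP=> r'; have [L pL sumL] := pm_sum bg pM pN.
  have: mate bg v \notin L by rewrite sumL ?mate_in // r' (negPf rN).
  by move/(fout _ pL); rewrite sumL // (negPf f') (negPf (fout _ pN rN)).
apply/eqP; rewrite eqEsubset; apply/andP; split; last first.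
  by rewrite !subUset !sub1set fC C1 C2.
apply/subsetP=> e eC; rewrite !inE -orbA; apply/or3P.
have [M pM eM] := mc_edge mcG e.
case: (boolP (f \in M)) => f'.
  by constructor 1; apply/eqP/(tight_uniq pM).
move: (star_pm bg pM c12 c1M c2M vc1 vc2); rewrite (negPf (rout _ pM f')).
case: (boolP (c1 \in M)) => [c1'|_].
  by constructor 2; apply/eqP/(tight_uniq pM).
case: (boolP (c2 \in M)) => // c2' _.
by constructor 3; apply/eqP/(tight_uniq pM).
Qed.

End TightCuts.

(** * Contractions *)

Lemma pm_intro (G : mgraph) (M : {set edge G}) :
  (forall v, exists2 a, a \in M /\ v \in ends a &
     forall b, b \in M -> v \in ends b -> b = a) -> perfect_matching M.
Proof.
move=> H; apply/forallP=> v; have [a [aM va] uni] := H v.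
apply/cards1P; exists a; apply/setP=> b; rewrite !inE.
by apply/andP/eqP=> [[]|->//]; apply: uni.
Qed.

Section Contraction.
Variables (G : mgraph) (X : {set vertex G}).
Implicit Types (u v x y : vertex G) (e f : edge G) (M : {set edge G}).
Local Notation GX := (shrink X).

Definition proj (x : vertex G) : vertex GX := shrink_vertex X x.
Definition apex : vertex GX := None.
Definition orig (e : edge GX) : edge G := val e.

Lemma orig_inj : injective orig.
Proof. exact: val_inj. Qed.

Lemma orig_hits (e : edge GX) : ends (orig e) :&: X != set0.
Proof. exact: valP e. Qed.

Lemma shrink_out x : x \notin X -> proj x = apex.
Proof. by move=> xX; rewrite /proj /shrink_vertex insubN. Qed.

Lemma shrink_in x : x \in X -> proj x != apex.
Proof. by move=> xX; rewrite /proj /shrink_vertex insubT. Qed.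

Lemma shrink_inj x y : x \in X -> proj x = proj y -> x = y.
Proof.
move=> xX; rewrite /proj /shrink_vertex insubT /=.
by case: insubP => // z _ <- [<-].
Qed.

Lemma shrink_neq x y : (x \in X) || (y \in X) -> x != y -> proj x != proj y.
Proof.
by move=> /orP[xX|yX]; apply: contraNneq;
  [move/(shrink_inj xX)->|move/esym/(shrink_inj yX)->].
Qed.

Lemma shrink_vertexP (y : vertex GX) :
  y = apex \/ exists2 x, x \in X & y = proj x.
Proof.
case: y => [[x xX]|]; [right|by left].
by exists x => //; rewrite /proj /shrink_vertex insubT.
Qed.

Lemma ends_shrink (e : edge GX) x y :
  ends (orig e) = [set x; y] -> ends e = [set proj x; proj y].
Proof. by move=> E; rewrite [LHS]/= /shrink_ends; rewrite /orig in E; rewrite E imsetU1 imset_set1. Qed.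

Lemma hitsE e x y : ends e = [set x; y] ->
  (ends e :&: X != set0) = (x \in X) || (y \in X).
Proof.
move=> E; rewrite E; apply/set0Pn/orP=> [[z]|].
  by rewrite !inE => /andP[/orP[]/eqP->]; [left|right].
by case=> h; [exists x|exists y]; rewrite !inE eqxx ?orbT.
Qed.

Lemma edge_lift e x y : ends e = [set x; y] -> (x \in X) || (y \in X) ->
  exists e' : edge GX, orig e' = e.
Proof. by move=> E; rewrite -(hitsE E) => h; exists (exist _ e h). Qed.

Lemma mem_ends_in (e : edge GX) x : x \in X ->
  (proj x \in ends e) = (x \in ends (orig e)).
Proof.
move=> xX; have [y [z E]] := ends2 (orig e).
have E' := ends_shrink E; rewrite E' E !inE.
by congr orb; apply/eqP/eqP=> [|->//]; apply: shrink_inj.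
Qed.

Lemma mem_ends_apex (e : edge GX) : (apex \in ends e) = (orig e \in cut X).
Proof.
have [y [z E]] := ends2 (orig e); have := orig_hits e; rewrite (hitsE E).
have E' := ends_shrink E; rewrite (mem_cut _ E) E' !inE.
case yX: (y \in X); case zX: (z \in X) => //= _.
- by rewrite !(eq_sym apex) !(negPf (shrink_in _)).
- by rewrite (shrink_out (negbT zX)) eqxx orbT.
- by rewrite (shrink_out (negbT yX)) eqxx.
Qed.

Definition restr M : {set edge GX} := orig @^-1: M.

Lemma card_restr M : (forall e, e \in M -> ends e :&: X != set0) ->
  #|restr M| = #|M|.
Proof.
move=> H; rewrite -(card_imset (restr M) orig_inj); apply: eq_card => e.
apply/imsetP/idP=> [[e' + ->]|eM]; first by rewrite inE.
by exists (exist _ e (H e eM)); rewrite ?inE.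
Qed.

Lemma restr_incident M x : x \in X ->
  #|restr M :&: incident (proj x)| = #|M :&: incident x|.
Proof.
move=> xX; rewrite -card_restr => [|e]; last first.
  by rewrite !inE => /andP[_ xe]; apply/set0Pn; exists x; rewrite inE xe.
by apply: eq_card => e; rewrite !in_setI !in_set mem_ends_in.
Qed.

(** With [restr_incident] this computes every degree in the contraction, so cubicity and perfect
    matchings pass to it alike. *)
Lemma restr_apex M :
  #|restr M :&: incident apex| = #|M :&: cut X|.
Proof.
rewrite -card_restr => [|e]; last first.
  by rewrite !inE => /andP[_ /eqP e1]; rewrite -card_gt0 e1.
by apply: eq_card => e; rewrite !in_setI [in LHS]in_set [RHS]in_set in_setI
  [_ \in incident _]in_set mem_ends_apex.
Qed.

Lemma shrink_cubic : cubic G -> #|cut X| = 3 -> cubic GX.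
Proof.
move=> cubG c3; apply/forallP=> y.
have full : restr setT = setT by apply/setP=> e; rewrite !inE.
have [->|[x xX ->]] := shrink_vertexP y.
  by rewrite -[incident _]setTI -full restr_apex setTI c3.
by rewrite -[incident _]setTI -full restr_incident // setTI; apply: (forallP cubG).
Qed.

Hypothesis tX : tight X.

Lemma restr_pm M : perfect_matching M -> perfect_matching (restr M).
Proof.
move=> pM; apply/forallP=> y; have [->|[x xX ->]] := shrink_vertexP y.
  by rewrite restr_apex (tight_card tX pM).
by rewrite restr_incident //; apply: (forallP pM).
Qed.

Lemma shrink_connected : connected G -> ~: X != set0 -> connected GX.
Proof.
move=> con /set0Pn[o]; rewrite inE => oX.
have all_sv (y : vertex GX) : exists x, y = proj x.
  have [->|[x _ ->]] := shrink_vertexP y; last by exists x.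
  by exists o; rewrite shrink_out.
apply/forallP=> a; apply/forallP=> b.
have [[x ->] [y ->]] := (all_sv a, all_sv b).
have /connectP[p pth ->] := forallP (forallP con x) y.
elim: p x pth {a b} => [|z p IH] x /=; first by rewrite connect0.
case/andP=> /existsP[e /eqP E] /IH; apply: connect_trans.
case xz: ((x \in X) || (z \in X)).
  have [e' E'] := edge_lift E xz; apply: connect1; apply/existsP; exists e'.
  by rewrite -E' in E; have E2 := ends_shrink E; rewrite E2.
by move/norP: (negbT xz) => [xX zX]; rewrite !shrink_out // connect0.
Qed.

Lemma shrink_mc : matching_covered G -> nontrivial X -> matching_covered GX.
Proof.
move=> mcG /andP[X1 X2]; have /and3P[con _ _] := mcG; apply/and3P; split.
- by apply: shrink_connected => //; rewrite -card_gt0; apply: ltn_trans X2.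
- by rewrite card_option card_sig ltnS (eq_card (B := mem X)) // ltnW.
- apply/forallP=> e; have [M pM eM] := mc_edge mcG (orig e).
  by apply/existsP; exists (restr M); rewrite restr_pm // inE.
Qed.

Lemma cut_outer e : e \in cut X -> exists2 v, v \notin X & v \in ends e.
Proof.
have [x [y E]] := ends2 e; rewrite (mem_cut _ E) E.
by case xX: (x \in X) => //=; [move=> h; exists y | move=> _; exists x];
  rewrite ?xX // !inE eqxx ?orbT.
Qed.

Lemma cut_outer_uniq e u v : e \in cut X -> u \in ends e -> v \in ends e ->
  u \notin X -> v \notin X -> u = v.
Proof.
have [x [y E]] := ends2 e; rewrite (mem_cut _ E) E !inE.
by move=> xy /orP[]/eqP-> /orP[]/eqP-> // aX bX; move: xy aX bX;
  case: (x \in X); case: (y \in X).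
Qed.

(** [M1] is kept on the edges meeting [X] and [N] on the others. They fit because the cut edges they
    use, [orig e1] and [c], have the same end [v] outside [X]; every other outer vertex is covered
    by [N] away from the cut. *)
Lemma pm_lift (M1 : {set edge GX}) (e1 : edge GX) N c v :
  perfect_matching M1 -> perfect_matching N -> e1 \in M1 -> apex \in ends e1 ->
  c \in N -> c \in cut X -> v \notin X -> v \in ends (orig e1) -> v \in ends c ->
  exists M, [/\ perfect_matching M, restr M = M1 &
    forall e, ends e :&: X = set0 -> (e \in M) = (e \in N)].
Proof.
move=> pM1 pN e1M e1N cN cC vX ve1 vc.
pose M := [set orig e | e : edge GX in M1] :|: [set e in N | ends e :&: X == set0].
have e1C : orig e1 \in cut X by rewrite -mem_ends_apex.
have inM (e : edge GX) : (orig e \in M) = (e \in M1).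
  rewrite in_setU [X in _ || X]in_set (negPf (orig_hits e)) andbF orbF.
  by rewrite mem_imset //; apply: orig_inj.
have outM e : ends e :&: X = set0 -> (e \in M) = (e \in N).
  move=> h; rewrite in_setU [X in _ || X]in_set h eqxx andbT.
  case: imsetP => //= -[e' _ ee']; have := orig_hits e'; rewrite -ee' /=.
  by rewrite h eqxx.
exists M; split=> //; last by apply/setP=> e; rewrite inE inM.
apply: pm_intro => x; case: (boolP (x \in X)) => xX.
  have [e eM xe] := pm_cover (proj x) pM1; rewrite mem_ends_in // in xe.
  exists (orig e); first by rewrite inM.
  move=> b bM xb; have [y _ E] := endsP xb.
  have [b' E'] := edge_lift E (introT orP (or_introl xX)).
  rewrite -E' in bM xb *; rewrite inM in bM; congr orig.
  by apply: (pm_uniq pM1 bM eM (v := proj x)); rewrite mem_ends_in.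
have hit_cut a : x \in ends a -> ends a :&: X != set0 -> a \in cut X.
  move=> xa; have [y _ E] := endsP xa; rewrite (hitsE E) (mem_cut _ E).
  by rewrite (negPf xX).
have hit_e1 a : a \in M -> x \in ends a -> ends a :&: X != set0 -> a = orig e1.
  move=> aM xa ha; have E : orig (exist _ a ha : edge GX) = a by [].
  rewrite -E inM in aM; rewrite -{1}E; congr orig.
  by apply: (pm_uniq pM1 aM e1M (v := apex)); rewrite // mem_ends_apex hit_cut.
have [e eN xe] := pm_cover x pN.
case: (eqVneq (ends e :&: X) set0) => he.
  exists e; first by rewrite outM.
  move=> b bM xb; case: (eqVneq (ends b :&: X) set0) => hb.
    by rewrite outM // in bM; apply: pm_uniq pN bM eN xb xe.
  have bE := hit_e1 b bM xb hb.
  have xv : x = v by apply: (cut_outer_uniq e1C); rewrite // -bE.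
  rewrite xv in xe; have ec := pm_uniq pN eN cN xe vc.
  by move: cC; rewrite -ec inE he cards0.
have ec := tight_uniq tX pN eN cN (hit_cut e xe he) cC.
have xv : x = v by apply: (cut_outer_uniq cC); rewrite // -ec.
exists (orig e1); first by rewrite inM xv.
move=> b bM xb; case: (eqVneq (ends b :&: X) set0) => hb; last exact: hit_e1.
rewrite outM // in bM; have bc : b = c by apply: pm_uniq pN bM cN xb _; rewrite xv.
by move: cC; rewrite -bc inE hb cards0.
Qed.

Lemma pm_lift_mc (M1 : {set edge GX}) : matching_covered G ->
  perfect_matching M1 -> exists2 M, perfect_matching M & restr M = M1.
Proof.
move=> mcG pM1; have [e1 e1M e1N] := pm_cover apex pM1.
(* Taking [N] through [orig e1] itself makes the outer ends agree. *)
have [N pN eN] := mc_edge mcG (orig e1).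
have e1C : orig e1 \in cut X by rewrite -mem_ends_apex.
have [v vX ve] := cut_outer e1C.
by have [M [pM rM _]] := pm_lift pM1 pN e1M e1N eN e1C vX ve ve; exists M.
Qed.

End Contraction.

(** * Blocks under contraction of a tight cut *)

Section Heredity.
Variables (G : mgraph) (M0 : {set edge G}) (bg : block_graph M0).
Variable X : {set vertex G}.
Hypotheses (tX : tight X) (nX : nontrivial X).
Local Notation GX := (shrink X).
Implicit Types (u v x y : vertex G) (e f : edge G) (M : {set edge G}).

Let mcG := bg_mc bg.
Let cubG := bg_cubic bg.
Let pm0 := bg_pm bg.

Lemma mem_restr M (e : edge GX) : (e \in restr X M) = (orig e \in M).
Proof. by rewrite inE. Qed.

(* A block meeting both sides of the cut has exactly one vertex on one of them:
   if that vertex is in X the block becomes a digon, otherwise it is kept, with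
   the vertex replaced by the apex. *)
Lemma block_shrink x (a b : edge GX) : a != b ->
  orig a \notin M0 -> orig b \notin M0 ->
  x \in ends (orig a) -> x \in ends (orig b) ->
  block (restr X M0) (proj X x) a b.
Proof.
move=> ab aM bM xa xb; have ab' : orig a != orig b by rewrite (inj_eq (@orig_inj _ _)).
have [p E1 E2|p q c3 pq c3M E1 E2 E3|p q w c3 c4 h pq xw c3M c4M hM E1 E2 E3 E4 H] :=
    bg_block bg ab' aM bM xa xb.
- by apply: Digon (ends_shrink E1) (ends_shrink E2).
- case pqX: ((p \in X) || (q \in X)); last first.
    move: pqX => /norP[pX qX]; apply: (@Digon _ _ _ _ _ (apex X)).
      by rewrite -(shrink_out pX); apply: ends_shrink.
    by rewrite -(shrink_out qX); apply: ends_shrink.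
  have [c E] := edge_lift E3 pqX; rewrite -E in E3 c3M.
  apply: (@Triangle _ _ _ _ _ (proj X p) (proj X q) c); try exact: ends_shrink.
    exact: shrink_neq.
  by rewrite mem_restr.
- have := orig_hits a; have := orig_hits b; rewrite (hitsE _ E1) (hitsE _ E2).
  have N1 : ~~ ((orig a \in cut X) && (c4 \in cut X)).
    apply/negP=> /andP[C1 C4].
    exact: (quad_cut bg tX pq xw aM bM c3M c4M hM E1 E2 E3 E4 H C1 C4).
  have H' : ends h = [set x; w] \/ ends h = [set q; p].
    by case: H; [left|rewrite setUC; right].
  have qp : q != p by rewrite eq_sym.
  have N2 : ~~ ((orig b \in cut X) && (c3 \in cut X)).
    apply/negP=> /andP[C1 C4].
    exact: (quad_cut bg tX qp xw bM aM c4M c3M hM E2 E1 E4 E3 H' C1 C4).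
  move: N1 N2; rewrite (mem_cut _ E1) (mem_cut _ E2) (mem_cut _ E3) (mem_cut _ E4).
  move=> N1 N2 X1 X2.
  case pqX: ((p \in X) || (q \in X)); last first.
    move: pqX => /norP[pX qX]; apply: (@Digon _ _ _ _ _ (apex X)).
      by rewrite -(shrink_out pX); apply: ends_shrink.
    by rewrite -(shrink_out qX); apply: ends_shrink.
  (* With opposite pairs excluded, at most one of the four vertices is outside [X], so the whole
     cycle and its chord survive. *)
  have /and3P[xwX pwX qwX] : [&& (x \in X) || (w \in X), (p \in X) || (w \in X)
      & (q \in X) || (w \in X)].
    by move: N1 N2 X1 X2 pqX; case: (x \in X); case: (w \in X); case: (p \in X);
      case: (q \in X).
  have [d3 D3] := edge_lift E3 pwX; have [d4 D4] := edge_lift E4 qwX.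
  have [d D] : exists d : edge GX, orig d = h.
    by case: H => E; apply: (edge_lift E).
  rewrite -D3 in E3 c3M; rewrite -D4 in E4 c4M; rewrite -D in H hM.
  apply: (@Quad _ _ _ _ _ (proj X p) (proj X q) (proj X w) d3 d4 d);
    try exact: ends_shrink; rewrite ?mem_restr //; try exact: shrink_neq.
  by case: H => E; [left|right]; apply: ends_shrink.
Qed.

Lemma shrink_block_graph : block_graph (restr X M0).
Proof.
have [v [c1 [c2 [f [[c12 c1M c2M vc1 vc2] [fM cE]]]]]] := tight_cut_struct bg tX.
split; first exact: shrink_mc.
- apply: shrink_cubic => //.
  rewrite cE -setUA cardsU1 cards2 c12 !inE negb_or.
  by rewrite (memPn c1M) // (memPn c2M).
- exact: restr_pm.
move=> y a b ab; rewrite !mem_restr => aM bM ya yb.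
have [yE|[x xX yE]] := shrink_vertexP y; rewrite yE in ya yb *; last first.
  by rewrite !mem_ends_in // in ya yb; apply: block_shrink.
rewrite !mem_ends_apex in ya yb.
have F_at e : e \notin M0 -> e \in cut X -> v \in ends e.
  rewrite cE !inE -orbA => eM /or3P[]/eqP eE; rewrite ?eE //.
  by rewrite eE fM in eM.
have [va vb] := (F_at _ aM ya, F_at _ bM yb).
case: (boolP (v \in X)) => vX; last first.
  by rewrite -(shrink_out vX); apply: block_shrink.
have dig (e : edge GX) : v \in ends (orig e) -> orig e \in cut X ->
    ends e = [set apex X; proj X v].
  move=> ve eC; have [p _ E] := endsP ve; move: eC; rewrite (mem_cut _ E) vX /=.
  by move=> pX; rewrite -(shrink_out pX) setUC; apply: ends_shrink.
exact: Digon (dig a va ya) (dig b vb yb).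
Qed.

End Heredity.

(** * Avoidable triangle edges and their additivity along tight cuts *)

Definition ftriangle (G : mgraph) (M0 : {set edge G}) (e : edge G) : bool :=
  [exists p, exists q, exists u, exists c2, exists c3,
    [&& e \notin M0, c2 \notin M0, c3 \notin M0, ends e == [set p; q],
        ends c2 == [set p; u] & ends c3 == [set q; u]]].

Lemma ftriangleP (G : mgraph) (M0 : {set edge G}) (e : edge G) :
  reflect (exists p q u c2 c3, [/\ e \notin M0, c2 \notin M0 & c3 \notin M0] /\
    [/\ ends e = [set p; q], ends c2 = [set p; u] & ends c3 = [set q; u]])
    (ftriangle M0 e).
Proof.
apply: (iffP existsP) => [[p /existsP[q /existsP[u /existsP[c2 /existsP[c3]]]]]|].
  by case/and5P=> ? ? ? /eqP? /andP[/eqP? /eqP?]; exists p, q, u, c2, c3.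
case=> p [q [u [c2 [c3 [[? ? ?] [E1 E2 E3]]]]]]; exists p.
apply/existsP; exists q; apply/existsP; exists u; apply/existsP; exists c2.
by apply/existsP; exists c3; apply/and5P; split=> //; rewrite ?E1 ?E2 ?E3 ?eqxx.
Qed.

(** The matching condition of removability, without connectedness. The latter is automatic for a
    cubic matching covered graph, and this form can be carried through contractions. *)
Definition avoidable (G : mgraph) (e : edge G) : bool :=
  [forall f, (f != e) ==> [exists M, [&& perfect_matching M, f \in M & e \notin M]]].

Lemma avoidableP (G : mgraph) (e : edge G) :
  reflect (forall f, f != e ->
    exists M, [/\ perfect_matching M, f \in M & e \notin M]) (avoidable e).
Proof.
apply: (iffP forallP) => H f; last first.
  by apply/implyP=> /H[M [? ? ?]]; apply/existsP; exists M; apply/and3P.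
by move: (H f) => /implyP h /h/existsP[M /and3P[? ? ?]]; exists M.
Qed.

Definition solid (G : mgraph) (M0 : {set edge G}) : {set edge G} :=
  [set e | ftriangle M0 e && avoidable e].

Lemma ends_eq (G : mgraph) (e : edge G) x y :
  x \in ends e -> y \in ends e -> x != y -> ends e = [set x; y].
Proof.
move=> xe ye xy; apply/esym/eqP; rewrite eqEcard (eqP (ends_card2 e)) cards2 xy.
by rewrite subUset !sub1set xe ye.
Qed.

Section Solid.
Variables (G : mgraph) (M0 : {set edge G}) (bg : block_graph M0).
Variables (X : {set vertex G}) (v : vertex G).
Hypothesis (tX : tight X).
Hypothesis vX : exists c1 c2 f,
  [/\ c1 != c2, c1 \notin M0, c2 \notin M0, v \in ends c1 & v \in ends c2] /\
  f \in M0 /\ cut X = [set f; c1; c2].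
Local Notation GX := (shrink X).
Implicit Types (u x y : vertex G) (e f : edge G) (M : {set edge G}).

Let mcG := bg_mc bg.

Lemma cut_F e : e \notin M0 -> (e \in cut X) = (v \in ends e).
Proof.
have [c1 [c2 [f [[c12 c1M c2M vc1 vc2] [fM cE]]]]] := vX => eM.
have star_v := star bg c12 c1M c2M vc1 vc2.
have -> : (v \in ends e) = (e \in incident v) by rewrite inE.
rewrite cE star_v !inE -!orbA; congr orb.
have ef : e != f by apply: contraNneq eM => ->.
have em : e != mate bg v by apply: contraNneq eM => ->; apply: mate_in.
by rewrite (negPf ef) (negPf em).
Qed.

(** If [v] lies outside [X], all F-edges at the apex end at [v], so the apex can be read as [v]. *)
Lemma orig_ends (e : edge GX) x y : orig e \notin M0 ->
  x \in X \/ x = v /\ v \notin X -> y \in X \/ y = v /\ v \notin X ->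
  ends e = [set proj X x; proj X y] -> ends (orig e) = [set x; y].
Proof.
move=> eM hx hy E.
have step z : z \in X \/ z = v /\ v \notin X -> proj X z \in ends e -> z \in ends (orig e).
  case=> [zX|[-> vX']]; first by rewrite mem_ends_in.
  by rewrite (shrink_out vX') mem_ends_apex cut_F.
apply: ends_eq; [apply: step hx _|apply: step hy _|]; rewrite ?E ?set21 ?set22 //.
by apply: contra (ends_neq E) => /eqP->.
Qed.

(** With [v] in [X] the two F-edges at the apex form a digon, so no F-triangle passes through it;
    otherwise the apex is renamed to [v]. *)
Lemma ftriangle_orig (e : edge GX) : ftriangle (restr X M0) e ->
  ftriangle M0 (orig e) && ~~ ((v \in X) && (orig e \in cut X)).
Proof.
case/ftriangleP=> p [q [u [c2 [c3]]]]; rewrite !mem_restr.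
case=> -[eM c2M c3M] [E1 E2 E3].
have dig (c : edge GX) : v \in X -> orig c \notin M0 -> apex X \in ends c ->
    ends c = [set apex X; proj X v].
  move=> vX' cM; rewrite mem_ends_apex => cC.
  have := cC; rewrite cut_F // => vc; have [z _ E] := endsP vc.
  move: cC; rewrite (mem_cut _ E) vX' /= => zX.
  by rewrite -(shrink_out zX) setUC; apply: ends_shrink.
have noapex : v \in X -> [/\ p != apex X, q != apex X & u != apex X].
  move=> vX'; have two (a b : edge GX) r s : orig a \notin M0 -> orig b \notin M0 ->
      ends a = [set apex X; r] -> ends b = [set apex X; s] -> r = s.
    move=> aM bM Ea Eb; have := dig a vX' aM (end1 Ea).
    have := dig b vX' bM (end1 Eb); rewrite Ea Eb => Eb' Ea'.
    by rewrite -Ea' in Eb'; rewrite -Eb in Eb'; rewrite (ends_inj Eb' Eb).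
  split; apply/eqP=> h; rewrite h in E1 E2 E3.
  - by have := ends_neq E3; rewrite (two _ _ _ _ eM c2M E1 E2) eqxx.
  - rewrite setUC in E1.
    by have := ends_neq E2; rewrite (two _ _ _ _ eM c3M E1 E3) eqxx.
  - rewrite setUC in E2; rewrite setUC in E3.
    by have := ends_neq E1; rewrite (two _ _ _ _ c2M c3M E2 E3) eqxx.
have pre (y : vertex GX) : (v \in X -> y != apex X) ->
    exists2 x, y = proj X x & x \in X \/ x = v /\ v \notin X.
  move=> ny; have [yE|[x xX yE]] := shrink_vertexP y; last by exists x; [|left].
  case: (boolP (v \in X)) => vX'; first by have := ny vX'; rewrite yE eqxx.
  by exists v; [rewrite (shrink_out vX')|right].
have [|p0 pE hp] := pre p; first by move=> /noapex[].
have [|q0 qE hq] := pre q; first by move=> /noapex[].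
have [|u0 uE hu] := pre u; first by move=> /noapex[].
apply/andP; split.
  apply/ftriangleP; exists p0, q0, u0, (orig c2), (orig c3); split=> //.
  by split; apply: orig_ends; rewrite // -?pE -?qE -?uE.
apply/negP=> /andP[vX']; rewrite -mem_ends_apex E1 !inE.
by have [np nq _] := noapex vX'; rewrite !(eq_sym (apex X)) (negPf np) (negPf nq).
Qed.

(** A triangle with exactly one vertex in [X] has two cut edges there, so that vertex is [v], and
    its two edges at [v] are the excluded ones. *)
Lemma ftriangle_shrink (e : edge GX) : ftriangle M0 (orig e) ->
  ~~ ((v \in X) && (orig e \in cut X)) -> ftriangle (restr X M0) e.
Proof.
case/ftriangleP=> p [q [u [c2 [c3 [[eM c2M c3M] [E1 E2 E3]]]]]] ncut.
have pq := orig_hits e; rewrite (hitsE _ E1) in pq.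
have /andP[pu qu] : ((p \in X) || (u \in X)) && ((q \in X) || (u \in X)).
  have := cut_F c2M; have := cut_F c3M; have := cut_F eM; move: pq ncut.
  rewrite (mem_cut _ E1) (mem_cut _ E2) (mem_cut _ E3) E1 E2 E3 !inE.
  case: (eqVneq v p) => [->|_]; first by case: (p \in X); case: (q \in X); case: (u \in X).
  case: (eqVneq v q) => [->|_]; first by case: (p \in X); case: (q \in X); case: (u \in X).
  by case: (p \in X); case: (q \in X); case: (u \in X).
have [d2 D2] := edge_lift E2 pu; have [d3 D3] := edge_lift E3 qu.
rewrite -D2 in E2 c2M; rewrite -D3 in E3 c3M.
apply/ftriangleP; exists (proj X p), (proj X q), (proj X u), d2, d3.
by rewrite !mem_restr; split=> //; split; apply: ends_shrink.
Qed.

Lemma avoidable_shrink (e : edge GX) : avoidable (orig e) -> avoidable e.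
Proof.
move=> /avoidableP H; apply/avoidableP=> f fe.
have [|M [pM fM eM]] := H (orig f); first by rewrite (inj_eq (@orig_inj _ _)).
by exists (restr X M); rewrite !mem_restr restr_pm.
Qed.

(** If [f] meets [X], a matching of the contraction through [f] lifts. If not, a matching through
    [f] is used outside [X] and one avoiding [e] inside, glued along cut edges with the same outer
    end. *)
Lemma avoidable_orig (e : edge GX) : avoidable e ->
  orig e \notin cut X \/ v \notin X /\ orig e \notin M0 -> avoidable (orig e).
Proof.
move=> /avoidableP H hyp; apply/avoidableP=> f fe.
case: (eqVneq (ends f :&: X) set0) => fX; last first.
  have E : orig (exist _ f fX : edge GX) = f by [].
  have [|M1 [pM1 fM1 eM1]] := H (exist _ f fX).
    by rewrite -(inj_eq (@orig_inj _ _)) E.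
  have [M pM rM] := pm_lift_mc tX mcG pM1; exists M.
  by rewrite -E -!mem_restr rM.
have [N pN fN] := mc_edge mcG f.
have /card_gt0P[c] : 0 < #|N :&: cut X| by rewrite (tight_card tX pN).
case/setIP=> cN cC; have [o oX oc] := cut_outer cC.
have [x [y Ec]] := ends2 c; have := cC; rewrite (mem_cut _ Ec) => xyX.
have [c' c'E] : exists c' : edge GX, orig c' = c.
  by apply: (edge_lift Ec); move: xyX; case: (x \in X).
have lift (M1 : {set edge GX}) (d : edge GX) : perfect_matching M1 -> d \in M1 ->
    orig d \in cut X -> o \in ends (orig d) -> e \notin M1 ->
    exists M, [/\ perfect_matching M, f \in M & orig e \notin M].
  move=> pM1 dM1 dC od eM1; have da : apex X \in ends d by rewrite mem_ends_apex.
  have [M [pM rM outM]] := pm_lift tX pM1 pN dM1 da cN cC oX od oc.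
  by exists M; split=> //; [rewrite outM | rewrite -mem_restr rM].
case: (eqVneq c' e) => c'e; last first.
  have [M1 [pM1 c'M1 eM1]] := H c' c'e.
  by apply: (lift M1 c'); rewrite ?c'E.
(* Here [N] crosses the cut along [e] itself. The other F-edge [d] at [v] also ends at [v] outside
   [X], so a matching through [d] can take over inside [X]. *)
case: hyp => [|[vX' eM]]; first by rewrite -c'e c'E cC.
have [d [ed dM vd]] : exists d, [/\ orig e != d, d \notin M0 & v \in ends d].
  by apply: (F_other bg); rewrite -?cut_F // -c'e c'E.
have dC : d \in cut X by rewrite cut_F.
have ov : o = v.
  by apply: (cut_outer_uniq cC) => //; rewrite -cut_F // -c'E c'e.
have [M2 pM2 dM2] := mc_edge mcG d.
have [x' [y' Ed]] := ends2 d; have := dC; rewrite (mem_cut _ Ed) => xyX'.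
have [d' d'E] : exists d' : edge GX, orig d' = d.
  by apply: (edge_lift Ed); move: xyX'; case: (x' \in X).
apply: (lift (restr X M2) d'); rewrite ?restr_pm ?mem_restr ?d'E ?ov //.
apply/negP=> eM2; move: ed; rewrite (pm_uniq pM2 eM2 dM2 _ vd) ?eqxx //.
by rewrite -cut_F // -c'e c'E.
Qed.

Lemma solid_shrink (e : edge GX) : (e \in solid (restr X M0)) =
  (orig e \in solid M0) && ~~ ((v \in X) && (orig e \in cut X)).
Proof.
rewrite [LHS]inE [_ \in solid M0]inE; apply/andP/andP=> [[te ae]|[/andP[te ae] nc]].
  have /andP[to nc] := ftriangle_orig te; split=> //; rewrite to /=.
  apply: avoidable_orig => //.
  case: (boolP (orig e \in cut X)) => [eC|]; [right|by left].
  have /ftriangleP[p [q [u [c2 [c3 [[eM _ _] _]]]]]] := to; split=> //.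
  by move: nc; rewrite eC andbT.
by split; [apply: ftriangle_shrink|apply: avoidable_shrink].
Qed.

Lemma card_solid_shrink : #|solid (restr X M0)| = #|solid M0 :&:
  [set e | (ends e :&: X != set0) && ~~ ((v \in X) && (e \in cut X))]|.
Proof.
rewrite -(card_imset _ (@orig_inj G X)); apply: eq_card => e.
apply/imsetP/idP=> [[e' + ->]|].
  by rewrite solid_shrink => /andP[eS nc]; rewrite in_setI eS in_set orig_hits.
rewrite in_setI in_set => /and3P[eS eX nc].
by exists (exist _ e eX : edge GX) => //; rewrite solid_shrink; apply/andP.
Qed.

End Solid.

(** An edge off the cut lives in one contraction only. A solid cut edge lives in both but, by
    [solid_shrink], is counted only on the side not containing [v]. *)
Lemma card_solid (G : mgraph) (M0 : {set edge G}) (X : {set vertex G}) :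
  block_graph M0 -> tight X ->
  #|solid M0| = #|solid (restr X M0)| + #|solid (restr (~: X) M0)|.
Proof.
move=> bg tX; have [v vX] := tight_cut_struct bg tX.
have tX' : tight (~: X) by rewrite tightC.
rewrite (card_solid_shrink bg tX vX) (card_solid_shrink (v := v) bg tX') ?cutC //.
rewrite -[LHS](cardsID [set e | (ends e :&: X != set0)
  && ~~ ((v \in X) && (e \in cut X))]); congr addn.
apply: eq_card => e; rewrite !in_setI setDE in_setI; congr andb.
have [x [y E]] := ends2 e; rewrite !inE.
have -> : (#|ends e :&: X| == 1) = (e \in cut X) by rewrite inE.
rewrite (mem_cut _ E) !(hitsE _ E) !inE.
by case: (x \in X); case: (y \in X); case: (v \in X).
Qed.

(** * Bricks *)

Section CutSpace.
Import GRing.Theory.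
Local Open Scope ring_scope.
Variable G : mgraph.

(* Over F_2 the row space of the incidence matrix is the orthogonal of its
   kernel. *)
Lemma cut_space (D : {set edge G}) :
  (forall z : {set edge G}, (forall v, ~~ odd #|z :&: incident v|) ->
     ~~ odd #|D :&: z|) -> exists Y : {set vertex G}, cut Y = D.
Proof.
move=> orth.
pose A : 'M['F_2]_(#|vertex G|, #|edge G|) :=
  \matrix_(i, j) (enum_val i \in ends (enum_val j))%:R.
pose w : 'rV['F_2]_#|edge G| := \row_j (enum_val j \in D)%:R.
have rank_sum (T : finType) (F : 'I_#|T| -> 'F_2) : \sum_j F j = \sum_x F (enum_rank x).
  by rewrite (reindex _ (onW_bij _ (enum_rank_bij T))).
have F2E (a : 'F_2) : a = (a != 0)%:R by case: a => [[|[|//]]] ?; apply/val_inj.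
have F2odd n : (n%:R == 0 :> 'F_2) = ~~ odd n.
  by rewrite -dvdn2 (dvdn_pcharf (pchar_Fp (isT : prime 2))).
have sumE (B : {set edge G}) (z : 'cV['F_2]_#|edge G|) :
    \sum_j (enum_val j \in B)%:R * z j 0
    = #|B :&: [set e | z (enum_rank e) 0 != 0]|%:R.
  rewrite -[#|_ :&: _|]sum1_card natr_sum [RHS]big_mkcond /= rank_sum.
  apply: eq_bigr => e _; rewrite enum_rankK !inE [z _ _ in LHS]F2E.
  by case: (e \in B); case: (z _ _ != 0); rewrite ?mulr1 ?mulr0.
(* A row lies in the row space of [A] as soon as it annihilates the columns of the cokernel; each
   such column is the indicator of an edge set with even degrees, to which [orth] applies. *)
have /submxP[m mE] : (w <= A)%MS.
  rewrite submxE; apply/eqP/matrixP=> i k; rewrite ord1 mxE [RHS]mxE.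
  pose z := col k (cokermx A).
  rewrite (eq_bigr (fun j => (enum_val j \in D)%:R * z j 0)) => [|j _]; last by rewrite !mxE.
  rewrite sumE; apply/eqP; rewrite F2odd; apply: orth => v.
  rewrite -F2odd setIC -sumE.
  have := congr1 (fun B : 'M_(_, _) => B (enum_rank v) k) (mulmx_coker A).
  rewrite mxE [X in _ = X]mxE => vE; apply/eqP; rewrite -[RHS]vE.
  by apply: eq_bigr => j _; rewrite !mxE enum_rankK inE.
(* The coefficients of the combination of rows pick the side of the cut: an edge xy is in [D] iff
   exactly one of its ends has coefficient 1. *)
exists [set v | m 0 (enum_rank v) != 0]; apply/setP=> e.
have := congr1 (fun B : 'M_(_, _) => B 0 (enum_rank e)) mE.
rewrite /w !mxE enum_rankK => eE.
have [x [y E]] := ends2 e; rewrite (mem_cut _ E) !inE.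
have xy := ends_neq E.
have : ((e \in D)%:R : 'F_2) = m 0 (enum_rank x) + m 0 (enum_rank y).
  rewrite eE rank_sum (bigD1 x) //= (bigD1 y) ?(eq_sym y) //=.
  rewrite !mxE !enum_rankK E !set21 !set22 !mulr1 big1 ?addr0 // => v /andP[vx vy].
  by rewrite mxE !enum_rankK E !inE (negPf vx) (negPf vy) mulr0.
rewrite (F2E (m 0 (enum_rank x))) (F2E (m 0 (enum_rank y))).
by case: (e \in D); case: (m _ _ != 0); case: (m _ _ != 0) => // /eqP.
Qed.

End CutSpace.

Lemma handshake (G : mgraph) (A : {set edge G}) :
  \sum_v #|A :&: incident v| = #|A| * 2.
Proof.
rewrite (eq_bigr (fun v => \sum_(e in A | v \in ends e) 1)) => [|v _]; last first.
  by rewrite -sum1_card; apply: eq_bigl => e; rewrite !inE.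
rewrite (exchange_big_dep (mem A)) /=; last by move=> ? ? _ /andP[].
rewrite -sum_nat_const; apply: eq_bigr => e eA.
by rewrite -(eqP (ends_card2 e)) -sum1_card; apply: eq_bigl => v; rewrite eA.
Qed.

(** * Small edge cuts in the absence of nontrivial tight cuts *)

Section SmallCuts.
Variable G : mgraph.
Hypotheses (mcG : matching_covered G) (cubG : cubic G).
Hypothesis noT : ~~ has_nontrivial_tight_cut G.
Implicit Types (Y X : {set vertex G}) (M : {set edge G}).

Lemma no_tight X : tight X -> ~~ nontrivial X.
Proof.
by move=> tX; move/existsPn/(_ X): noT; rewrite tX andbT.
Qed.

Lemma odd_tight X : (forall M, perfect_matching M -> #|M :&: cut X| <= 2) ->
  odd #|X| -> tight X.
Proof.
move=> le2 oX; apply/forallP=> M; apply/implyP=> pM.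
by have := le2 M pM; have := pm_parity X pM; rewrite oX; case: #|_| => [|[|[|]]].
Qed.

(** With an odd side such a cut is tight by parity, and a side with one vertex would give three cut
    edges. An even side is first made odd by moving one vertex. *)
Lemma small_cut Y : #|cut Y| <= 2 -> Y != set0 -> Y != setT -> #|vertex G| <= 4.
Proof.
move=> c2 Y0 YT; rewrite leqNgt; apply/negP=> n4.
(* With more than four vertices one side has at least three, which leaves two after a vertex is
   moved across the cut. *)
wlog big : Y c2 Y0 YT / 2 < #|~: Y|.
  move=> H; case: (ltnP 2 #|~: Y|) => [|small]; first exact: H.
  apply: (H (~: Y)); rewrite ?cutC ?setCK //.
  - by rewrite -setCT (inj_eq (@setC_inj _)).
  - by rewrite -setC0 (inj_eq (@setC_inj _)).
  by move: n4; rewrite -(cardsC Y) => n4; move: (leq_trans n4 (leq_add (leqnn _) small));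
    rewrite addn2 !ltnS.
have leM M : #|M :&: cut Y| <= 2.
  by apply: leq_trans c2; rewrite subset_leq_card ?subsetIr.
case oY: (odd #|Y|).
  have tY : tight Y by apply: odd_tight.
  have /negP[] := no_tight tY; rewrite /nontrivial (ltn_trans _ big) // andbT.
  rewrite ltn_neqAle card_gt0 Y0 andbT; apply/eqP=> /esym/eqP/cards1P[v vE].
  by move: c2; rewrite vE cut_set1 incident3.
have /set0Pn[s sC] := mc_cut mcG Y0 YT.
have [y yY ys] := cut_outer sC.
(* A matching using no edge of [cut Y] meets [cut X] only in its edge at [y]. One that does use some
   uses all of [cut Y] by parity, hence contains [s], which is then its edge at [y] and adds nothing
   new. *)
pose X := y |: Y.
have oX : odd #|X| by rewrite cardsU1 yY /= oY.
have tX : tight X.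
  apply: odd_tight => // M pM.
  have sub : M :&: cut X \subset (M :&: cut Y) :|: (M :&: incident y).
    apply/subsetP=> e; rewrite !in_setU !in_setI => /andP[-> /=].
    have [a [b E]] := ends2 e.
    rewrite !(mem_cut _ E) !inE E !inE (eq_sym y a) (eq_sym y b).
    by case: (a == y); case: (b == y); rewrite ?orbT //= => ->.
  have y1 : #|M :&: incident y| = 1 by apply/eqP/(forallP pM).
  case: (eqVneq (M :&: cut Y) set0) => [MY|].
    by apply: leq_trans (subset_leq_card sub) _; rewrite MY set0U y1.
  rewrite -card_gt0 => MY; have MY2 : M :&: cut Y = cut Y.
    apply/eqP; rewrite eqEcard subsetIr /=; apply: leq_trans c2 _.
    by have := pm_parity Y pM; rewrite oY; case: #|_| MY => [|[|]].
  have sM : s \in M by move: sC; rewrite -MY2 inE => /andP[].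
  apply: leq_trans (leM M); apply: subset_leq_card; apply/subsetP=> e eX.
  have := subsetP sub e eX; rewrite in_setU => /orP[//|].
  rewrite in_setI [_ \in incident y]inE => /andP[eM ye].
  by rewrite (pm_uniq pM eM sM ye ys) in_setI sM.
have /negP[] := no_tight tX; rewrite /nontrivial.
have -> : 1 < #|X| by rewrite cardsU1 yY ltnS card_gt0.
by rewrite setCU -setDE setDE setIC -setDE cardsD (setIidPr _) ?sub1set ?inE // cards1 ltn_subRL.
Qed.

End SmallCuts.

(** * F consists of triangles, and its matchings *)

Section TriangleFactor.
Variables (G : mgraph) (M0 : {set edge G}) (bg : block_graph M0).
Hypothesis noT : ~~ has_nontrivial_tight_cut G.
Hypothesis n4 : 4 < #|vertex G|.
Implicit Types (u v x y p q : vertex G) (e f : edge G) (M : {set edge G}).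
Implicit Types (X Y : {set vertex G}).

Let mcG := bg_mc bg.
Let cubG := bg_cubic bg.
Let pm0 := bg_pm bg.

Lemma small_cutF Y : #|cut Y| <= 2 -> Y != set0 -> #|Y| <= 4 -> False.
Proof.
move=> c2 Y0 Y4; have YT : Y != setT.
  by apply: contraTneq Y4 => ->; rewrite cardsT -ltnNge.
by have := small_cut mcG cubG noT c2 Y0 YT; rewrite leqNgt n4.
Qed.

Definition is_tri v p q c1 c2 c3 :=
  [/\ c1 \notin M0, c2 \notin M0 & c3 \notin M0] /\
  [/\ ends c1 = [set v; p], ends c2 = [set v; q] & ends c3 = [set p; q]].

Lemma is_tri_swap v p q c1 c2 c3 :
  is_tri v p q c1 c2 c3 -> is_tri v q p c2 c1 c3.
Proof. by case=> -[? ? ?] [? ? E3]; do 2!split=> //; rewrite setUC. Qed.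

Lemma is_tri_rot v p q c1 c2 c3 :
  is_tri v p q c1 c2 c3 -> is_tri p v q c1 c3 c2.
Proof. by case=> -[? ? ?] [E1 ? ?]; do 2!split=> //; rewrite setUC. Qed.

Lemma F_star v c1 c2 e : c1 != c2 -> c1 \notin M0 -> c2 \notin M0 ->
  v \in ends c1 -> v \in ends c2 -> e \notin M0 -> v \in ends e ->
  e = c1 \/ e = c2.
Proof.
move=> c12 c1M c2M vc1 vc2 eM ve.
have : e \in incident v by rewrite inE.
rewrite (star bg c12 c1M c2M vc1 vc2) !inE -orbA => /or3P[]/eqP eE.
- by rewrite eE mate_in in eM.
- by left.
- by right.
Qed.

(** Around a digon, or around a chorded 4-cycle, at most two [M0]-edges leave, which [small_cutF]
    forbids. *)
Lemma block_tri v c1 c2 : c1 != c2 -> c1 \notin M0 -> c2 \notin M0 ->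
  v \in ends c1 -> v \in ends c2 ->
  exists p q c3, is_tri v p q c1 c2 c3.
Proof.
move=> c12 c1M c2M vc1 vc2.
have [p E1 E2|p q c3 pq c3M E1 E2 E3|p q w c3 c4 h pq vw c3M c4M hM E1 E2 E3 E4 H] :=
  bg_block bg c12 c1M c2M vc1 vc2; last 2 first.
- by exists p, q, c3.
- exfalso; pose Y := [set v; p; q; w].
  have out y c c' x x' : y \in Y -> c != c' -> c \notin M0 -> c' \notin M0 ->
      ends c = [set y; x] -> ends c' = [set y; x'] -> x \in Y -> x' \in Y ->
      forall e, e \in cut Y -> y \in ends e -> e = mate bg y.
    move=> yY cc' cM c'M E E' xY x'Y e eC ye.
    have : e \in incident y by rewrite inE.
    rewrite (star bg cc' cM c'M (end1 E) (end1 E')) !inE -orbA => /or3P[]/eqP eE //.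
      by move: eC; rewrite eE (mem_cut _ E) yY xY.
    by move: eC; rewrite eE (mem_cut _ E') yY x'Y.
  have vY : v \in Y by rewrite !inE eqxx.
  have pY : p \in Y by rewrite !inE eqxx orbT.
  have qY : q \in Y by rewrite !inE eqxx !orbT.
  have wY : w \in Y by rewrite !inE eqxx !orbT.
  have E1' : ends c1 = [set p; v] by rewrite setUC.
  have E2' : ends c2 = [set q; v] by rewrite setUC.
  have E3' : ends c3 = [set w; p] by rewrite setUC.
  have E4' : ends c4 = [set w; q] by rewrite setUC.
  have cv := out v _ _ _ _ vY c12 c1M c2M E1 E2 pY qY.
  have cp := out p _ _ _ _ pY (edges_neq E1' E3 vw) c1M c3M E1' E3 vY wY.
  have cq := out q _ _ _ _ qY (edges_neq E2' E4 vw) c2M c4M E2' E4 vY wY.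
  have cw := out w _ _ _ _ wY (edges_neq E3' E4' pq) c3M c4M E3' E4' pY qY.
  have cY e : e \in cut Y -> exists2 y, y \in Y & e = mate bg y.
    have [a [b E]] := ends2 e => eC; have := eC; rewrite (mem_cut _ E) => abY.
    have [y yY ye] : exists2 y, y \in Y & y \in ends e.
      by rewrite E; case: (boolP (a \in Y)) abY => aY /= bY; [exists a|exists b];
        rewrite ?set21 ?set22.
    exists y => //; move: yY; rewrite !inE -!orbA => /or4P[]/eqP yE; rewrite yE in ye *.
    + exact: cv. + exact: cp. + exact: cq. + exact: cw.
  have Y4 : #|Y| <= 4.
    rewrite /Y -!setUA; do 3!(apply: leq_trans (leq_card_setU _ _) _; rewrite cards1 add1n ltnS).
    by rewrite cards1.
  have Y0 : Y != set0 by apply/set0Pn; exists v.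
  case: H => hE.
    have hv := mate_uniq bg hM (end1 hE); have hw := mate_uniq bg hM (end2 hE).
    apply: small_cutF Y0 Y4; apply: (@leq_trans #|[set mate bg p; mate bg q]|).
      apply/subset_leq_card/subsetP=> e eC; have [y yY eE] := cY e eC.
      have hC : h \notin cut Y by rewrite (mem_cut _ hE) vY wY.
      move: yY; rewrite eE !inE -!orbA => /or4P[]/eqP yE; rewrite yE ?eqxx ?orbT //.
        by rewrite eE yE hv (negPf hC) in eC.
      by rewrite eE yE hw (negPf hC) in eC.
    by rewrite cards2; case: (_ != _).
  have hp := mate_uniq bg hM (end1 hE); have hq := mate_uniq bg hM (end2 hE).
  apply: small_cutF Y0 Y4; apply: (@leq_trans #|[set mate bg v; mate bg w]|).
    apply/subset_leq_card/subsetP=> e eC; have [y yY eE] := cY e eC.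
    have hC : h \notin cut Y by rewrite (mem_cut _ hE) pY qY.
    move: yY; rewrite eE !inE -!orbA => /or4P[]/eqP yE; rewrite yE ?eqxx ?orbT //.
      by rewrite eE yE hp (negPf hC) in eC.
    by rewrite eE yE hq (negPf hC) in eC.
  by rewrite cards2; case: (_ != _).
exfalso; pose Y := [set v; p].
have vY : v \in Y by rewrite set21.
have pY : p \in Y by rewrite set22.
apply: (@small_cutF Y).
- apply: (@leq_trans #|[set mate bg v; mate bg p]|).
    apply/subset_leq_card/subsetP=> e eC; have [a [b E]] := ends2 e.
    have cC c : ends c = Y -> c \notin cut Y by move=> Ec; rewrite (mem_cut _ Ec) vY pY.
    have [y yY ye] : exists2 y, y \in Y & y \in ends e.
      by move: eC; rewrite (mem_cut _ E) E; case: (boolP (a \in Y)) => aY /= bY;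
        [exists a|exists b]; rewrite ?set21 ?set22.
    have [yc1 yc2] : y \in ends c1 /\ y \in ends c2 by rewrite E1 E2.
    have : e \in incident y by rewrite inE.
    rewrite (star bg c12 c1M c2M yc1 yc2) !inE -orbA => /or3P[]/eqP eE.
    + by move: yY; rewrite eE !inE => /orP[]/eqP->; rewrite eqxx ?orbT.
    + by move: (cC _ E1); rewrite -eE eC.
    + by move: (cC _ E2); rewrite -eE eC.
  by rewrite cards2; case: (_ != _).
- by apply/set0Pn; exists v.
- by rewrite cards2; case: (_ != _).
Qed.

Lemma triP v : exists p q c1 c2 c3, is_tri v p q c1 c2 c3.
Proof.
have [c1 [c2 [c12 c1M c2M vc1 vc2]]] := F_pair bg v.
have [p [q [c3 T]]] := block_tri c12 c1M c2M vc1 vc2.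
by exists p, q, c1, c2, c3.
Qed.

Lemma edge_tri v p c1 : c1 \notin M0 -> ends c1 = [set v; p] ->
  exists q c2 c3, is_tri v p q c1 c2 c3.
Proof.
move=> c1M E1; have vc1 := end1 E1.
have [c2 [c12 c2M vc2]] := F_other bg c1M vc1.
have [p' [q [c3 T]]] := block_tri c12 c1M c2M vc1 vc2.
have [_ [E1' _ _]] := T; have pE := ends_inj E1' E1; rewrite pE in T.
by exists q, c2, c3.
Qed.

(** The closed neighbourhood in F, so that the triangle through [v] is obtained without choosing
    labels. *)
Definition tri v : {set vertex G} :=
  v |: [set x | [exists c, (c \notin M0) && (ends c == [set v; x])]].

Lemma tri_set v p q c1 c2 c3 : is_tri v p q c1 c2 c3 -> tri v = [set v; p; q].
Proof.
case=> -[c1M c2M c3M] [E1 E2 E3]; have pq := ends_neq E3.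
apply/setP=> x; rewrite !inE -orbA; congr orb; apply/existsP/orP=> [[c]|].
  case/andP=> cM /eqP E; have c12 := edges_neq E1 E2 pq.
  have [] := F_star c12 c1M c2M (end1 E1) (end1 E2) cM (end1 E) => cE; rewrite cE in E.
    by left; rewrite (ends_inj E1 E).
  by right; rewrite (ends_inj E2 E).
by case=> /eqP->; [exists c1|exists c2]; rewrite ?c1M ?c2M ?E1 ?E2 /=.
Qed.

Lemma tri_self v : v \in tri v.
Proof. by rewrite !inE eqxx. Qed.

Lemma tri_adj e x y : e \notin M0 -> ends e = [set x; y] -> y \in tri x.
Proof.
by move=> eM E; rewrite !inE; apply/orP; right; apply/existsP; exists e; rewrite eM E /=.
Qed.

Lemma tri_edge x y : y \in tri x -> x != y ->
  exists2 e, e \notin M0 & ends e = [set x; y].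
Proof.
rewrite !inE eq_sym => /orP[->//|/existsP[e /andP[eM /eqP E]] _].
by exists e.
Qed.

Lemma card_tri v : #|tri v| = 3.
Proof.
have [p [q [c1 [c2 [c3 T]]]]] := triP v; rewrite (tri_set T).
have [_ [E1 E2 E3]] := T; rewrite -setUA cardsU1 cards2 !inE negb_or.
by rewrite (ends_neq E1) (ends_neq E2) (ends_neq E3).
Qed.

Lemma tri_eq x v : x \in tri v -> tri x = tri v.
Proof.
have [p [q [c1 [c2 [c3 T]]]]] := triP v; rewrite (tri_set T) !inE -orbA.
case/or3P=> /eqP->; first exact: tri_set T.
  by rewrite (tri_set (is_tri_rot T)) [in LHS](setUC [set p]).
rewrite (tri_set (is_tri_rot (is_tri_swap T))) [in LHS](setUC [set q]).
by rewrite -!setUA (setUC [set q]).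
Qed.

Lemma tri_sym x y : (x \in tri y) = (tri x == tri y).
Proof. by apply/idP/eqP=> [|<-]; [apply: tri_eq|apply: tri_self]. Qed.

Lemma cut_tri_closed Y e : (forall y, y \in Y -> tri y \subset Y) ->
  e \in cut Y -> e \in M0.
Proof.
move=> cl; have [x [y E]] := ends2 e; rewrite (mem_cut _ E) => xy.
apply: contraT => eM; have yx := tri_adj eM E.
have xy' : x \in tri y by apply: (tri_adj eM); rewrite setUC.
move: xy; case: (boolP (x \in Y)) => /= [xY|xY yY].
  by rewrite (subsetP (cl x xY) y yx).
by rewrite (subsetP (cl y yY) x xy') in xY.
Qed.

Lemma cut_ends Y e : e \in cut Y -> exists2 y, y \in Y & y \in ends e.
Proof.
have [a [b E]] := ends2 e; rewrite (mem_cut _ E) E.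
by case: (boolP (a \in Y)) => aY /= bY; [exists a|exists b]; rewrite ?set21 ?set22.
Qed.

Lemma tri_closed v y : y \in tri v -> tri y \subset tri v.
Proof. by move=> yv; rewrite (tri_eq yv). Qed.

(** An [M0]-edge between two vertices of a triangle would leave only the [M0]-edge at the third
    vertex to connect the triangle with the rest. *)
Lemma mate_tri x y : y \in tri x -> x != y -> mate bg x != mate bg y.
Proof.
move=> yx xy; have [e eM E] := tri_edge yx xy.
have [q [c2 [c3 T]]] := edge_tri eM E; have TE := tri_set T.
apply/eqP=> mxy; apply: (@small_cutF (tri x)); last by rewrite card_tri.
  apply: (@leq_trans #|[set mate bg q]|); last by rewrite cards1.
  apply/subset_leq_card/subsetP=> f fC; rewrite inE.
  have fM : f \in M0 by apply: cut_tri_closed fC; apply: tri_closed.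
  have [z zT zf] := cut_ends fC.
  have mE : ends (mate bg x) = [set x; y].
    by apply: ends_eq; rewrite ?mate_end // mxy mate_end.
  have mC : mate bg x \notin cut (tri x) by rewrite (mem_cut _ mE) tri_self yx.
  move: zT; rewrite TE !inE -orbA -(mate_uniq bg fM zf) => /or3P[]/eqP zE //.
  - by move: mC; rewrite -{1}zE (mate_uniq bg fM zf) fC.
  - by move: mC; rewrite mxy -zE (mate_uniq bg fM zf) fC.
  - by rewrite zE.
by apply/set0Pn; exists x; apply: tri_self.
Qed.

Lemma is_tri_pm M v p q c1 c2 c3 : is_tri v p q c1 c2 c3 -> perfect_matching M ->
  [/\ (mate bg v \in M) + (c1 \in M) + (c2 \in M) = 1,
      (mate bg p \in M) + (c1 \in M) + (c3 \in M) = 1 &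
      (mate bg q \in M) + (c2 \in M) + (c3 \in M) = 1].
Proof.
move=> T pM; have [[c1M c2M c3M] [E1 E2 E3]] := T.
have E1' : ends c1 = [set p; v] by rewrite setUC.
have E2' : ends c2 = [set q; v] by rewrite setUC.
have E3' : ends c3 = [set q; p] by rewrite setUC.
split.
- exact: star_pm2 pM (ends_neq E3) c1M c2M E1 E2.
- exact: star_pm2 pM (ends_neq E2) c1M c3M E1' E3.
- exact: star_pm2 pM (ends_neq E1) c2M c3M E2' E3'.
Qed.

(** Hence a perfect matching is determined by its [M0]-edges: in a triangle, an even number of
    vertices is matched inside, by the one edge between them. *)
Lemma pm_tri M e x y : perfect_matching M -> e \notin M0 -> ends e = [set x; y] ->
  (e \in M) = (mate bg x \notin M) && (mate bg y \notin M).
Proof.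
move=> pM eM E; have [q [c2 [c3 T]]] := edge_tri eM E.
have [] := is_tri_pm T pM.
by case: (mate bg x \in M); case: (mate bg y \in M); case: (mate bg q \in M); case: (e \in M);
  case: (c2 \in M); case: (c3 \in M).
Qed.

Lemma mate_distinct g h : g \in M0 -> h \in M0 ->
  (forall M, perfect_matching M -> (g \in M) = (h \in M)) -> g = h.
Proof.
move=> gM hM H; apply/eqP; apply: contraT => gh; exfalso.
have [|Y cY] := @cut_space G [set g; h].
  move=> z even.
  (* The [M0]-edges in [z] are removed from [M0] and the triangle edges joining their ends are
     added. This is a perfect matching: summing the even degrees over a triangle shows that 0 or 2
     of its three mates lie in [z]. *)
  pose M := [set e | if e \in M0 then e \notin z
                     else [forall x in ends e, mate bg x \in z]].
  have pM : perfect_matching M.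
    apply/forallP=> v; have [p [q [c1 [c2 [c3 T]]]]] := triP v.
    have [[c1M c2M c3M] [E1 E2 E3]] := T; have pq := ends_neq E3.
    have E1' : ends c1 = [set p; v] by rewrite setUC.
    have E2' : ends c2 = [set q; v] by rewrite setUC.
    have E3' : ends c3 = [set q; p] by rewrite setUC.
    have c12 := edges_neq E1 E2 pq.
    have c13 := edges_neq E1' E3 (ends_neq E2).
    have c23 := edges_neq E2' E3' (ends_neq E1).
    rewrite (star_card bg _ c12) ?(end1 E1) ?(end1 E2) // !inE mate_in.
    rewrite (negPf c1M) (negPf c2M) (allE _ E1) (allE _ E2).
    move: (even v) (even p) (even q).
    rewrite (star_card bg _ c12) ?(end1 E1) ?(end1 E2) //.
    rewrite (star_card bg _ c13) ?(end1 E1') ?(end1 E3) //.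
    rewrite (star_card bg _ c23) ?(end1 E2') ?(end1 E3') //.
    by case: (mate bg v \in z); case: (mate bg p \in z); case: (mate bg q \in z);
      case: (c1 \in z); case: (c2 \in z); case: (c3 \in z).
  have := H M pM; rewrite !inE gM hM => /negb_inj ghz.
  have -> : #|[set g; h] :&: z| = (g \in z) + (h \in z).
    rewrite -sum1_card (eq_bigl (fun e => (e \in [set g; h]) && (e \in z))) => [|e].
      by rewrite big_mkcondr /= big_setU1 ?inE // big_set1; do 2!case: (_ \in z).
    by rewrite inE.
  by rewrite ghz; case: (h \in z).
have Y0 : Y != set0.
  apply/eqP=> YE; have : g \in cut Y by rewrite cY set21.
  by rewrite YE inE setI0 cards0.
have YT : Y != setT.
  apply/eqP=> YE; have : g \in cut Y by rewrite cY set21.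
  by rewrite YE inE setIT (eqP (ends_card2 g)).
have := small_cut mcG cubG noT (Y := Y); rewrite cY cards2 gh => /(_ isT Y0 YT).
by rewrite leqNgt n4.
Qed.

End TriangleFactor.

(** * Parity of the order and the size of F *)

Section Counting.
Variables (G : mgraph) (M0 : {set edge G}) (bg : block_graph M0).

Lemma card_F : #|~: M0| = #|vertex G|.
Proof.
apply/eqP; rewrite -(eqn_pmul2r (isT : 0 < 2)) -handshake -sum_nat_const; apply/eqP.
apply: eq_bigr => v _; have [c1 [c2 [c12 c1M c2M vc1 vc2]]] := F_pair bg v.
by rewrite (star_card bg _ c12) // !in_setC mate_in (negPf c1M) (negPf c2M).
Qed.

Lemma even_order : ~~ odd #|vertex G|.
Proof.
rewrite -cardsT -(pm_parity setT (bg_pm bg)).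
have -> : cut [set: vertex G] = set0.
  by apply/setP=> e; rewrite !inE setIT (eqP (ends_card2 e)).
by rewrite setI0 cards0.
Qed.

Lemma ftriangle_F e : ftriangle M0 e -> e \notin M0.
Proof. by case/ftriangleP=> p [q [u [c2 [c3 [[]]]]]]. Qed.

Lemma solid_sub_F : solid M0 \subset ~: M0.
Proof.
by apply/subsetP=> e; rewrite [_ \in solid _]inE in_setC => /andP[/ftriangle_F].
Qed.

(** By parity there would be exactly one vertex outside the triangle; its F-edges would end on the
    triangle, where both F-edges at each vertex are already used. *)
Lemma ftriangle_small e : #|vertex G| <= 4 -> ~~ ftriangle M0 e.
Proof.
move=> n4; apply/negP.
case/ftriangleP=> p [q [u [c2 [c3 [[eM c2M c3M] [E1 E2 E3]]]]]].
have [pq pu qu] := And3 (ends_neq E1) (ends_neq E2) (ends_neq E3).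
pose T := [set p; q; u].
have T3 : #|T| = 3 by rewrite /T -setUA cardsU1 cards2 !inE negb_or pq pu qu.
have [x xT] : exists x, x \notin T.
  have : ~~ (setT \subset T).
    apply: contra even_order; rewrite subTset => /eqP TE.
    by rewrite -cardsT -TE T3.
  by case/subsetPn=> x _ xT; exists x.
have xTT : x |: T = setT.
  by apply/eqP; rewrite eqEcard subsetT cardsT cardsU1 xT T3.
have [c [_ [_ cM _ xc _]]] := F_pair bg x.
have [y xy E] := endsP xc.
have : y \in x |: T by rewrite xTT inE.
rewrite in_setU1 eq_sym (negPf xy) /= => yT.
have E1' : ends e = [set q; p] by rewrite setUC.
have E2' : ends c2 = [set u; p] by rewrite setUC.
have E3' : ends c3 = [set u; q] by rewrite setUC.
have yc := end2 E.
suff : [|| c == e, c == c2 | c == c3].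
  by case/or3P=> /eqP cE; move: xT; rewrite cE in xc; move: xc;
    rewrite ?E1 ?E2 ?E3 !inE => /orP[]->; rewrite ?orbT.
move: yT; rewrite !inE -orbA => /or3P[]/eqP yE; rewrite yE in yc.
- have [->|->] := F_star bg (edges_neq E1 E2 qu) eM c2M (end1 E1) (end1 E2) cM yc;
  by rewrite eqxx ?orbT.
- have [->|->] := F_star bg (edges_neq E1' E3 pu) eM c3M (end1 E1') (end1 E3) cM yc;
  by rewrite eqxx ?orbT.
- have [->|->] := F_star bg (edges_neq E2' E3' pq) c2M c3M (end1 E2') (end1 E3') cM yc;
  by rewrite eqxx ?orbT.
Qed.

Lemma solid_small : #|vertex G| <= 4 -> solid M0 = set0.
Proof.
move=> n4; apply/setP=> e; rewrite in_set0 in_set.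
by rewrite (negPf (ftriangle_small e n4)).
Qed.

Lemma solid_bipartite : bipartite G -> solid M0 = set0.
Proof.
case/existsP=> A /forallP bip.
apply/setP=> e; rewrite in_set0; apply/negP; rewrite in_set => /andP[+ _].
case/ftriangleP=> p [q [u [c2 [c3 [_ [E1 E2 E3]]]]]].
have inA f : f \in cut A by rewrite inE.
have := inA e; have := inA c2; have := inA c3.
rewrite (mem_cut _ E1) (mem_cut _ E2) (mem_cut _ E3).
by case: (p \in A); case: (q \in A); case: (u \in A).
Qed.

Lemma partner_exists x : exists w, ends (mate bg x) == [set x; w].
Proof.
by have [w _ E] := endsP (mate_end bg x); exists w; rewrite E.
Qed.

Definition partner x : vertex G := xchoose (partner_exists x).

Lemma partnerE x : ends (mate bg x) = [set x; partner x].
Proof. exact/eqP/(xchooseP (partner_exists x)). Qed.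

Lemma mate_partner x : mate bg (partner x) = mate bg x.
Proof. by apply: mate_uniq; [apply: mate_in|apply: end2 (partnerE x)]. Qed.

Lemma partnerK : involutive partner.
Proof.
move=> x; have := partnerE (partner x); rewrite mate_partner => E.
by apply: (ends_inj E); rewrite setUC partnerE.
Qed.

Lemma partner_neq x : partner x != x.
Proof. by rewrite eq_sym (ends_neq (partnerE x)). Qed.

End Counting.

(** * Bricks with more than four vertices *)

Section Bricks.
Variables (G : mgraph) (M0 : {set edge G}) (bg : block_graph M0).
Hypothesis noT : ~~ has_nontrivial_tight_cut G.
Hypothesis n4 : 4 < #|vertex G|.
Implicit Types (u v x y p q : vertex G) (e f : edge G) (M : {set edge G}).
Implicit Types (X Y : {set vertex G}).
Local Notation tri := (tri M0).
Local Notation mate := (mate bg).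
Local Notation partner := (partner bg).
Local Notation tri_eq := (tri_eq bg noT n4).
Local Notation tri_sym := (tri_sym bg noT n4).

Let mcG := bg_mc bg.
Let cubG := bg_cubic bg.
Let pm0 := bg_pm bg.

Lemma F_ftriangle e : e \notin M0 -> ftriangle M0 e.
Proof.
move=> eM; have [v [p E]] := ends2 e.
have [q [c2 [c3 [[_ c2M c3M] [_ E2 E3]]]]] := edge_tri bg noT n4 eM E.
by apply/ftriangleP; exists v, p, q, c2, c3.
Qed.

Lemma tri_disjoint x v z : x \notin tri v -> z \in tri x -> z \notin tri v.
Proof.
by rewrite !tri_sym => xv /eqP->.
Qed.

Lemma partner_tri x : partner x \notin tri x.
Proof.
apply/negP=> xt; have := mate_tri bg noT n4 xt; rewrite eq_sym partner_neq.
by rewrite mate_partner eqxx => /(_ isT).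
Qed.

Lemma partner_inj : injective partner.
Proof. exact: (can_inj (partnerK bg)). Qed.

(** At most two edges leave the union of the two triangles, so by [small_cut] a graph with further
    vertices is impossible. *)
Lemma two_links a b c d : b \in tri a -> a != b -> d \in tri c -> c != d ->
  c \notin tri a -> mate a = mate c -> mate b = mate d -> #|vertex G| <= 6.
Proof.
move=> ba ab dc cd ca mac mbd; pose Y := tri a :|: tri c.
have [e eM E] := tri_edge ba ab; have [f fM E'] := tri_edge dc cd.
have [u [c2 [c3 Ta]]] := edge_tri bg noT n4 eM E.
have [w [d2 [d3 Tc]]] := edge_tri bg noT n4 fM E'.
have Y6 : #|Y| <= 6.
  by apply: leq_trans (leq_card_setU _ _) _; rewrite !(card_tri bg noT n4).
case: (eqVneq Y setT) => [YT|YT]; first by rewrite -cardsT -YT.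
apply: leq_trans (_ : 4 <= 6) => //; apply: (small_cut mcG cubG noT _ _ YT).
  apply: (@leq_trans #|[set mate u; mate w]|); last by rewrite cards2; case: (_ != _).
  apply/subset_leq_card/subsetP=> g gC.
  have clos y : y \in Y -> tri y \subset Y.
    by rewrite in_setU => /orP[]/tri_eq->; [apply: subsetUl|apply: subsetUr].
  have gM := cut_tri_closed clos gC.
  have [y yY yg] := cut_ends gC; rewrite -(mate_uniq bg gM yg) in gC *.
  have inner x z : x \in Y -> z \in Y -> x != z -> mate x = mate z ->
      mate x \notin cut Y.
    move=> xY zY xz mxz; rewrite (mem_cut _ (_ : ends _ = [set x; z])) ?xY ?zY //.
    by apply: ends_eq; rewrite ?mate_end // mxz mate_end.
  have aY : a \in Y by rewrite in_setU tri_self.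
  have bY : b \in Y by rewrite in_setU ba.
  have cY : c \in Y by rewrite in_setU tri_self orbT.
  have dY : d \in Y by rewrite in_setU dc orbT.
  have ac : a != c by apply: contraNneq ca => <-; apply: tri_self.
  have bd : b != d.
    by apply: contraNneq (tri_disjoint ca dc) => <-.
  have Ca := inner _ _ aY cY ac mac; have Cb := inner _ _ bY dY bd mbd.
  move: yY; rewrite [y \in Y]in_setU (tri_set bg Ta) (tri_set bg Tc) !inE -!orbA.
  case/or3P=> [/eqP yE|/eqP yE|/or4P[]/eqP yE]; rewrite yE ?eqxx ?orbT // in gC *.
  - by rewrite gC in Ca.
  - by rewrite gC in Cb.
  - by rewrite mac gC in Ca.
  - by rewrite mbd gC in Cb.
by apply/set0Pn; exists a; rewrite in_setU tri_self.
Qed.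

(** A failing [f] = cd lies in another triangle than [e] = ab, and every perfect matching missing
    the mates of [c] and [d] also misses those of [a] and [b]. Linearity forces the latter mates to
    be the former, so that two [M0]-edges join the triangles. *)
Lemma F_avoidable e : 6 < #|vertex G| -> e \notin M0 -> avoidable e.
Proof.
move=> n6 eM; apply/avoidableP=> f fe.
case: (boolP (f \in M0)) => fM; first by exists M0.
have [a [b E]] := ends2 e; have [c [d Ef]] := ends2 f.
have [N pN fN] := mc_edge mcG f.
case: (boolP (e \in N)) => eN; last by exists N.
have ba := tri_adj eM E; have ab := ends_neq E.
have dc := tri_adj fM Ef; have cd := ends_neq Ef.
have off x : x \in ends e -> x \notin ends f.
  by move=> xe; apply: contra fe => xf; rewrite (pm_uniq pN fN eN xf xe).
have ca : c \notin tri a.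
  apply/negP=> ca; have := subsetP (tri_closed bg noT n4 ca) d dc => da.
  have [u [c2 [c3 T]]] := edge_tri bg noT n4 eM E.
  move: ca da; rewrite (tri_set bg T) !inE -!orbA.
  have [na nb] := (off a (end1 E), off b (end2 E)).
  move: na nb; rewrite Ef !inE !negb_or => /andP[ac ad] /andP[bc bd].
  rewrite !(eq_sym c) !(eq_sym d) (negPf ac) (negPf ad) (negPf bc) (negPf bd) /=.
  by move=> /eqP uc /eqP ud; move: cd; rewrite -uc -ud eqxx.
have mcd := mate_tri bg noT n4 dc cd; have mab := mate_tri bg noT n4 ba ab.
have [cN dN] : mate c \notin N /\ mate d \notin N.
  by apply/andP; rewrite -(pm_tri bg noT n4 pN fM Ef).
have [aN bN] : mate a \notin N /\ mate b \notin N.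
  by apply/andP; rewrite -(pm_tri bg noT n4 pN eM E).
case: (boolP [exists M, [&& perfect_matching M, f \in M & e \notin M]]).
  by case/existsP=> M /and3P[? ? ?]; exists M.
move=> /existsPn none; exfalso.
have key M : perfect_matching M -> mate c \notin M -> mate d \notin M ->
    mate a \notin M /\ mate b \notin M.
  move=> pM cM dM; have fM' : f \in M by rewrite (pm_tri bg noT n4 pM fM Ef) cM.
  have := none M; rewrite pM fM' /= negbK (pm_tri bg noT n4 pM eM E).
  by move/andP.
(* If the distinguishing matching contains [h] instead of [g], adding [N], which misses both,
   exchanges their roles. *)
have sep g h : g \in M0 -> h \in M0 -> g \notin N -> h \notin N -> g != h ->
    exists M, [/\ perfect_matching M, g \in M & h \notin M].
  move=> gM hM gN hN gh.
  have [M pM gh'] : exists2 M, perfect_matching M & (g \in M) != (h \in M).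
    case: (boolP [exists M, perfect_matching M && ((g \in M) != (h \in M))]).
      by case/existsP=> M /andP[? ?]; exists M.
    move=> /existsPn H; case/eqP: gh; apply: (mate_distinct bg noT n4) => // M pM.
    by apply/eqP; have := H M; rewrite pM negbK.
  case gM' : (g \in M) gh' => gh'.
    by exists M; split=> //; case: (h \in M) gh'.
  have [L pL sL] := pm_sum bg pM pN; exists L; split=> //.
    by rewrite sL // gM' (negPf gN).
  by rewrite sL // (negPf hN); case: (h \in M) gh'.
(* Otherwise take [M1] with [mate x] but not [mate c], and [M2] with [mate x] but not [mate d]. By
   [keyx] each contains the other of the two mates, so their sum contains [mate x] and misses both,
   against [keyx]. *)
have two x : mate x \notin N -> (forall M, perfect_matching M ->
    mate c \notin M -> mate d \notin M -> mate x \notin M) ->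
    mate x = mate c \/ mate x = mate d.
  move=> xN keyx; case: (eqVneq (mate x) (mate c)) => [->|xc]; first by left.
  case: (eqVneq (mate x) (mate d)) => [->|xd]; first by right.
  exfalso; have [M1 [p1 x1 c1]] := sep _ _ (mate_in bg x) (mate_in bg c) xN cN xc.
  have [M2 [p2 x2 d2]] := sep _ _ (mate_in bg x) (mate_in bg d) xN dN xd.
  case: (boolP (mate d \in M1)) => d1; last by move: (keyx M1 p1 c1 d1); rewrite x1.
  case: (boolP (mate c \in M2)) => c2; last by move: (keyx M2 p2 c2 d2); rewrite x2.
  have [L pL sL] := pm_sum bg p1 p2; have := keyx L pL.
  by rewrite !sL ?mate_in // x1 x2 (negPf c1) (negPf d2) d1 c2 => /(_ isT isT).
have A2 : mate a = mate c \/ mate a = mate d.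
  by apply: two => // M pM cM dM; case: (key M pM cM dM).
have B2 : mate b = mate c \/ mate b = mate d.
  by apply: two => // M pM cM dM; case: (key M pM cM dM).
suff : #|vertex G| <= 6 by rewrite leqNgt n6.
case: A2 B2 => [Ac|Ad] [Bc|Bd].
- by rewrite Ac Bc eqxx in mab.
- exact: two_links ba ab dc cd ca Ac Bd.
- have cdt : c \in tri d by rewrite tri_sym eq_sym -tri_sym.
  have dc' : d != c by rewrite eq_sym.
  have da : d \notin tri a.
    by apply: contra ca => /(tri_closed bg noT n4)/subsetP/(_ _ cdt).
  exact: two_links ba ab cdt dc' da Ad Bc.
- by rewrite Ad Bd eqxx in mab.
Qed.

Lemma card_solid_big : 6 < #|vertex G| -> #|solid M0| = #|vertex G|.
Proof.
move=> n6; rewrite -(card_F bg); apply: eq_card => e.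
apply/idP/idP=> [/(subsetP (solid_sub_F M0))//|]; rewrite in_setC => eM.
by rewrite in_set F_ftriangle // F_avoidable.
Qed.

Lemma order_mod3 : 3 %| #|vertex G|.
Proof.
have P := preim_partitionP tri [set: vertex G].
rewrite -cardsT (card_uniform_partition (n := 3) _ P) ?dvdn_mull // => B.
case/imsetP=> x _ ->; rewrite -(card_tri bg noT n4 x); apply: eq_card => y.
by rewrite in_set in_setT tri_sym eq_sym.
Qed.

Lemma order12 : 6 < #|vertex G| -> 12 <= #|vertex G|.
Proof.
move=> n6; have := even_order bg; have := order_mod3.
by move: #|_| n6 => [|[|[|[|[|[|[|[|[|[|[|[|n]]]]]]]]]]]].
Qed.

Lemma prism_links a b : #|vertex G| = 6 -> b \in tri a -> a != b ->
  partner b \in tri (partner a) /\ partner a != partner b.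
Proof.
move=> n6 ba ab; split; last by rewrite (inj_eq partner_inj).
have sub : tri (partner a) \subset ~: tri a.
  by apply/subsetP=> z; rewrite in_setC; apply/tri_disjoint/partner_tri.
have -> : tri (partner a) = ~: tri a.
  apply/eqP; rewrite eqEcard sub (card_tri bg noT n4) cardsCs setCK.
  by rewrite (card_tri bg noT n4) n6.
by rewrite in_setC -(tri_eq ba) partner_tri.
Qed.

(** The [M0]-edges at the ends of [e] lead to the ends of an edge [f] of the other triangle; by
    [pm_tri] the same perfect matchings contain [e] and [f]. *)
Lemma solid_prism : #|vertex G| = 6 -> solid M0 = set0.
Proof.
move=> n6; apply/setP=> e; rewrite in_set0; apply/negP; rewrite in_set.
case/andP=> /ftriangle_F eM /avoidableP av.
have [a [b E]] := ends2 e; have ba := tri_adj eM E; have ab := ends_neq E.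
have [pba pab] := prism_links n6 ba ab.
have [f fM Ef] := tri_edge pba pab.
have [|M [pM fM' eM']] := av f.
  apply: contraTneq (partner_tri a) => fe; rewrite negbK.
  have : partner a \in ends e by rewrite -fe (end1 Ef).
  by rewrite E => /set2P[/eqP|->//]; rewrite (negPf (partner_neq bg a)).
have := fM'; rewrite (pm_tri bg noT n4 pM fM Ef) !mate_partner.
by rewrite -(pm_tri bg noT n4 pM eM E) (negPf eM').
Qed.

Lemma adjE x y : adj x y = ((x != y) && (y \in tri x)) || (y == partner x).
Proof.
apply/existsP/orP=> [[e /eqP E]|[/andP[xy yx]|/eqP->]].
- case: (boolP (e \in M0)) => eM; [right|left].
    have := partnerE bg x; rewrite (mate_uniq bg eM (end1 E)) => E'.
    by rewrite (ends_inj E E').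
  by rewrite (ends_neq E) (tri_adj eM E).
- by have [e _ E] := tri_edge yx xy; exists e; rewrite E.
- by exists (mate x); rewrite partnerE.
Qed.

Lemma prism_iso : #|vertex G| = 6 -> underlying_iso G C6bar.
Proof.
move=> n6; rewrite /underlying_iso n6 eqxx /=.
have /card_gt0P[a _] : 0 < #|vertex G| by rewrite n6.
have [b [u [c1 [c2 [c3 T]]]]] := triP bg noT n4 a.
have TE := tri_set bg T; have [_ [E1 E2 E3]] := T.
have [ab au bu] := And3 (ends_neq E1) (ends_neq E2) (ends_neq E3).
(* In the complement of the hexagon, i is adjacent to i + 2, i - 2 and i + 3. So positions of equal
   parity hold a triangle, and partners are three apart. *)
pose s := [:: a; partner u; b; partner a; u; partner b].
have bT : b \in tri a by rewrite TE !inE eqxx ?orbT.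
have uT : u \in tri a by rewrite TE !inE eqxx ?orbT.
have paT := partner_tri a.
have pbT : partner b \notin tri a by rewrite -(tri_eq bT) partner_tri.
have puT : partner u \notin tri a by rewrite -(tri_eq uT) partner_tri.
have neqT x y : x \in tri a -> y \notin tri a -> (x == y) = false /\ (y == x) = false.
  by move=> xT yT; rewrite (eq_sym y); case: eqP => // xy; rewrite -xy xT in yT.
have us : uniq s.
  rewrite /s /= !inE !(inj_eq partner_inj) !negb_or.
  rewrite (negPf ab) (negPf au) (negPf bu) (eq_sym u) (negPf au) (eq_sym u) (negPf bu).
  have h := neqT _ _ (tri_self M0 a); have hb := neqT _ _ bT; have hu := neqT _ _ uT.
  by rewrite (h _ paT).1 (h _ pbT).1 (h _ puT).1 (hb _ paT).1 (hb _ pbT).1 (hb _ puT).2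
    (hu _ paT).2 (hu _ pbT).1 (hu _ puT).2.
have tri2 x y : (y \in tri x) = ((x \in tri a) == (y \in tri a)).
  have out z : z \notin tri a -> tri z = ~: tri a.
    move=> zT; apply/eqP; rewrite eqEcard; apply/andP; split.
      by apply/subsetP=> w; rewrite in_setC; apply: tri_disjoint.
    by rewrite cardsCs setCK !(card_tri bg noT n4) n6.
  case: (boolP (x \in tri a)) => xT; first by rewrite (tri_eq xT).
  by rewrite (out _ xT) in_setC.
pose f := [ffun i : 'I_6 => nth a s i].
apply/existsP; exists f; apply/andP; split.
  apply/injectiveP=> i j; rewrite !ffunE => /eqP; rewrite nth_uniq //.
  by move/eqP/val_inj.
have inT (i : 'I_6) : (nth a s i \in tri a) = ~~ odd i.
  by case: i => [[|[|[|[|[|[|//]]]]]] ?] /=; rewrite ?tri_self ?bT ?uT ?(negPf paT)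
    ?(negPf pbT) ?(negPf puT).
have pt (i : 'I_6) : partner (nth a s i) = nth a s ((i + 3) %% 6).
  by case: i => [[|[|[|[|[|[|//]]]]]] ?] /=; rewrite ?partnerK.
apply/forallP=> i; apply/forallP=> j; rewrite !ffunE adjE tri2 !inT pt.
rewrite !nth_uniq ?ltn_mod //.
by case: i => [[|[|[|[|[|[|//]]]]]] ?]; case: j => [[|[|[|[|[|[|//]]]]]] ?].
Qed.

End Bricks.

(** * Exceptional bricks and the contribution of each brick *)

Section SmallOrder.
Variables (G : mgraph) (M0 : {set edge G}) (bg : block_graph M0).
Local Notation mate := (mate bg).

Lemma bipartite2 : #|vertex G| = 2 -> bipartite G.
Proof.
move=> n2; have /card_gt0P[a _] : 0 < #|vertex G| by rewrite n2.
apply/existsP; exists [set a]; apply/forallP=> e.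
have -> : ends e = setT.
  by apply/eqP; rewrite eqEcard subsetT cardsT n2 (eqP (ends_card2 e)).
by rewrite setTI cards1.
Qed.

(** With [x] and [y] the partners of [v] and [p], the graph is the 4-cycle v, p, y, x with the edges
    vp and xy doubled. *)
Lemma digon_bipartite v p c1 c2 : #|vertex G| = 4 -> c1 != c2 ->
  c1 \notin M0 -> c2 \notin M0 -> ends c1 = [set v; p] -> ends c2 = [set v; p] ->
  bipartite G.
Proof.
move=> n4 c12 c1M c2M E1 E2; have vp := ends_neq E1.
have [vc1 pc1] := (end1 E1, end2 E1); have [vc2 pc2] := (end1 E2, end2 E2).
have fromY e z : z = v \/ z = p -> z \in ends e -> [\/ e = mate z, e = c1 | e = c2].
  move=> zE ze; have : e \in incident z by rewrite inE.
  have [zc1 zc2] : z \in ends c1 /\ z \in ends c2 by case: zE => ->.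
  by rewrite (star bg c12 c1M c2M zc1 zc2) !inE -orbA => /or3P[]/eqP->;
    [constructor 1|constructor 2|constructor 3].
(* Otherwise three parallel edges join [v] and [p], and no edge leaves this pair. *)
have mvp : mate v != mate p.
  apply/eqP=> mvp; have mE : ends (mate v) = [set v; p].
    by apply: ends_eq; rewrite ?mate_end // mvp mate_end.
  have : cut [set v; p] != set0.
    apply: (mc_cut (bg_mc bg)); first by apply/set0Pn; exists v; rewrite set21.
    by apply/eqP=> YT; move: n4; rewrite -cardsT -YT cards2; case: (_ != _).
  case/set0Pn=> e eC; have [a [b E]] := ends2 e.
  have cC c : ends c = [set v; p] -> c \notin cut [set v; p].
    by move=> Ec; rewrite (mem_cut _ Ec) set21 set22.
  have [z zE ze] : exists2 z, z = v \/ z = p & z \in ends e.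
    move: eC; rewrite (mem_cut _ E) E; case: (boolP (a \in _)) => aY /= bY.
      by exists a; [apply/set2P | rewrite set21].
    by exists b; [apply/set2P | rewrite set22].
  have := eC; have [->|->|->] := fromY e z zE ze; apply/negP; apply: cC => //.
  by case: zE => ->; rewrite -?mvp.
pose x := partner bg v; pose y := partner bg p.
have mx : mate x = mate v by apply: mate_partner.
have my : mate y = mate p by apply: mate_partner.
have xy : x != y by apply: contra mvp => /eqP xy; rewrite -mx xy my.
have vx : v != x by rewrite eq_sym partner_neq.
have py : p != y by rewrite eq_sym partner_neq.
have px : p != x by apply: contra mvp => /eqP px; rewrite px mx.
have vy : v != y by apply: contra mvp => /eqP vy; rewrite vy my.
have VT : [set v; p; x; y] = setT.
  apply/eqP; rewrite eqEcard subsetT cardsT n4 -!setUA !cardsU1 cards1 !inE.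
  by rewrite !negb_or vp vx vy px py xy.
apply/existsP; exists [set v; y]; apply/forallP=> e.
suff : e \in cut [set v; y] by rewrite inE.
have Cm c : ends c = [set v; p] -> c \in cut [set v; y].
  by move=> E; rewrite (mem_cut _ E) !inE eqxx (negPf py) (eq_sym p) (negPf vp).
have Cv : mate v \in cut [set v; y].
  by rewrite (mem_cut _ (partnerE bg v)) !inE eqxx -/x (eq_sym x v) (negPf vx) (negPf xy).
have Cp : mate p \in cut [set v; y].
  by rewrite (mem_cut _ (partnerE bg p)) !inE -/y eqxx orbT (eq_sym p v) (negPf vp) (negPf py).
have [a [b E]] := ends2 e.
have all z : [\/ z = v, z = p, z = x | z = y].
  have : z \in [set v; p; x; y] by rewrite VT inE.
  by rewrite !inE -!orbA => /or4P[]/eqP->;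
    [constructor 1|constructor 2|constructor 3|constructor 4].
case: (boolP (e \in M0)) => eM.
  rewrite -(mate_uniq bg eM (end1 E)).
  by have [->|->|->|->] := all a; rewrite ?mx ?my.
have Fvp z : z = v \/ z = p -> z \in ends e -> e \in cut [set v; y].
  move=> zE ze; have [eE|->|->] := fromY e z zE ze; try exact: Cm.
  by rewrite eE mate_in in eM.
have ab := ends_neq E; rewrite (mem_cut _ E) !inE.
have := Fvp a; have := Fvp b; rewrite (end1 E) (end2 E) (mem_cut _ E) !inE.
move: ab; have [->|->|->|->] := all a => ab; first by move=> _ /(_ (or_introl erefl) isT).
- by move=> _ /(_ (or_intror erefl) isT).
- move=> + _; move: ab; have [->|->|->|->] := all b; rewrite ?eqxx //.
  + by move=> _ /(_ (or_introl erefl) isT).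
  + by move=> _ /(_ (or_intror erefl) isT).
  + by move=> _ _; rewrite ?orbT (eq_sym x v) (negPf vx) (negPf xy).
- move=> + _; move: ab; have [->|->|->|->] := all b; rewrite ?eqxx //.
  + by move=> _ /(_ (or_introl erefl) isT).
  + by move=> _ /(_ (or_intror erefl) isT).
  + by move=> _ _; rewrite ?orbT (eq_sym x v) (negPf vx) (negPf xy).
Qed.

(** The order is 4. A digon would make the graph bipartite and [ftriangle_small] excludes triangles,
    so F is a 4-cycle; one chord lies in [M0], and the remaining two vertices are then partners. *)
Lemma K4_iso : #|vertex G| <= 4 -> ~~ bipartite G -> underlying_iso G K4.
Proof.
move=> n4 nbip; have n1 : 1 < #|vertex G| by case/and3P: (bg_mc bg).
have n4' : #|vertex G| = 4.
  have n2 : #|vertex G| <> 2 by move/bipartite2; apply/negP.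
  have := even_order bg; move: n1 n4 n2.
  by case: #|vertex G| => [|[|[|[|[|]]]]].
rewrite /underlying_iso n4' eqxx /=.
have full (v x : vertex G) : v != x -> adj v x.
  have [c1 [c2 [c12 c1M c2M vc1 vc2]]] := F_pair bg v.
  have [p E1 E2|p q c3 pq c3M E1 E2 E3|p q w c3 c4 h pq vw c3M c4M hM E1 E2 E3 E4 H] :=
    bg_block bg c12 c1M c2M vc1 vc2.
  - by case/negP: nbip; apply: digon_bipartite n4' c12 c1M c2M E1 E2.
  - case/negP: (ftriangle_small bg c1 n4); apply/ftriangleP.
    by exists v, p, q, c2, c3.
  have VT : [set v; p; q; w] = setT.
    apply/eqP; rewrite eqEcard subsetT cardsT n4' -!setUA !cardsU1 cards1 !inE.
    rewrite !negb_or vw pq (ends_neq E1) (ends_neq E2) (ends_neq E3).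
    by rewrite (ends_neq E4).
  have : x \in [set v; p; q; w] by rewrite VT inE.
  rewrite !inE -!orbA => /or4P[]/eqP-> vx.
  - by rewrite eqxx in vx.
  - by apply/existsP; exists c1; rewrite E1.
  - by apply/existsP; exists c2; rewrite E2.
  have [hE|hE] := H; first by apply/existsP; exists h; rewrite hE.
  apply/existsP; exists (mate v); apply/eqP/ends_eq=> //; first exact: mate_end.
  have : partner bg v \in [set v; p; q; w] by rewrite VT inE.
  rewrite !inE -!orbA (negPf (partner_neq bg v)) /= => /or3P[]/eqP pE.
  - have := mate_partner bg v; rewrite pE (mate_uniq bg hM (end1 hE)) => hv.
    have := mate_end bg v; rewrite -hv hE !inE => /orP[]/eqP vE.
      by have := ends_neq E1; rewrite vE eqxx.
    by have := ends_neq E2; rewrite vE eqxx.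
  - have := mate_partner bg v; rewrite pE (mate_uniq bg hM (end2 hE)) => hv.
    have := mate_end bg v; rewrite -hv hE !inE => /orP[]/eqP vE.
      by have := ends_neq E1; rewrite vE eqxx.
    by have := ends_neq E2; rewrite vE eqxx.
  by rewrite -pE -(mate_partner bg) mate_end.
pose f := [ffun i : 'I_4 => enum_val (cast_ord (esym n4') i)].
have fI : injective f.
  by move=> i j; rewrite !ffunE => /enum_val_inj/cast_ord_inj.
apply/existsP; exists f; apply/andP; split; first exact/injectiveP.
apply/forallP=> i; apply/forallP=> j; rewrite /K4.
case: (eqVneq i j) => [->|ij]; last by rewrite full // (inj_eq fI).
suff -> : adj (f j) (f j) = false by [].
by apply/negbTE/existsPn=> e; apply/eqP=> /ends_neq; rewrite eqxx.
Qed.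

(** The Boolean acts as a multiplicity: up to four vertices there is no F-triangle, in the prism no
    triangle edge is avoidable, and beyond six vertices all of F counts. *)
Lemma brick_solid : brick G -> #|solid M0| = star_brick G * #|vertex G|.
Proof.
move=> Gb; have /and3P[_ noT nbip] := Gb; rewrite /star_brick Gb /=.
case: (leqP #|vertex G| 4) => n4.
  by rewrite K4_iso // solid_small // cards0.
have -> : underlying_iso G K4 = false.
  by rewrite /underlying_iso; case: eqP => // n; rewrite n in n4.
case: (leqP #|vertex G| 6) => n6.
  have n6' : #|vertex G| = 6.
    have := even_order bg; move: n4 n6.
    by case: #|vertex G| => [|[|[|[|[|[|[|]]]]]]].
  by rewrite (prism_iso bg noT n4 n6') (solid_prism bg noT n4 n6') cards0.
have -> : underlying_iso G C6bar = false.
  by rewrite /underlying_iso; case: eqP => // n; rewrite n in n6.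
by rewrite (card_solid_big bg noT n4 n6) mul1n.
Qed.

Lemma star_brick_order : star_brick G -> 12 <= #|vertex G|.
Proof.
case/and3P=> Gb nK4 nC6; have /and3P[_ noT nbip] := Gb.
case: (leqP #|vertex G| 4) => n4; first by rewrite K4_iso in nK4.
case: (leqP #|vertex G| 6) => n6; last exact: (order12 bg noT n4 n6).
have n6' : #|vertex G| = 6.
  have := even_order bg; move: n4 n6.
  by case: #|vertex G| => [|[|[|[|[|[|[|]]]]]]].
by rewrite (prism_iso bg noT n4 n6') in nC6.
Qed.

End SmallOrder.

(** [M0] varies in the induction, as each contraction carries its own restriction. The lower bound
    is conditional because one side of a cut may count nothing. *)
Lemma decomposition_solid (G : mgraph) (M0 : {set edge G}) Ds :
  block_graph M0 -> tight_cut_decomposition G Ds ->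
  #|solid M0| = \sum_(B <- star_bricks Ds) #|vertex B| /\
  (0 < #|solid M0| -> 0 < bstar Ds /\ 12 <= #|solid M0|).
Proof.
move=> bg tcd; rewrite /bstar.
elim: tcd M0 bg => {G Ds} [G Gb|G X Ds1 Ds2 nX tX _ IH1 _ IH2] M0 bg.
  rewrite /star_bricks /=; case: (boolP (brick G)) Gb => /= [Gb _|nGb Gb]; last first.
    have -> : star_brick G = false by rewrite /star_brick (negPf nGb).
    have /and3P[_ _ bip] := Gb.
    by rewrite big_nil (solid_bipartite M0 bip) cards0.
  rewrite (brick_solid bg Gb); case: ifP => sb; last by rewrite big_nil.
  by rewrite big_seq1 mul1n /= (star_brick_order bg sb).
have nX' : nontrivial (~: X) by rewrite nontrivialC.
have tX' : tight (~: X) by rewrite tightC.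
have [S1 P1] := IH1 _ (shrink_block_graph bg tX nX).
have [S2 P2] := IH2 _ (shrink_block_graph bg tX' nX').
rewrite (card_solid bg tX) /star_bricks filter_cat big_cat size_cat S1 S2.
rewrite -S1 -S2 in P1 P2 *; split=> //.
case: (posnP #|solid (restr X M0)|) => [->|p1]; last first.
  move=> _; have [b1 s1] := P1 p1; rewrite addn_gt0 b1; split=> //.
  exact: leq_trans s1 (leq_addr _ _).
by rewrite add0n => p2; have [b2 s2] := P2 p2; rewrite addn_gt0 b2 orbT.
Qed.

Lemma decomposition_exists (G : mgraph) :
  matching_covered G -> exists Ds, tight_cut_decomposition G Ds.
Proof.
have [n] := ubnP #|vertex G|; elim: n G => // n IH G Gn mcG.
case: (boolP (has_nontrivial_tight_cut G)) => [|noT]; last first.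
  exists [:: G]; apply: TCD_leaf; rewrite /brick /brace mcG noT.
  by case: (bipartite G).
case/existsP=> X /andP[nX tX].
(* The contraction has one vertex besides [Y], while the complement of [Y] has at least two. *)
have sm (Y : {set vertex G}) : nontrivial Y -> #|vertex (shrink Y)| < n.
  case/andP=> Y1 Y2; apply: leq_trans (_ : #|vertex G| <= n) => //.
  rewrite card_option card_sig (eq_card (B := mem Y)) // -(cardsC Y).
  by rewrite -[_.+2]addn2 leq_add2l.
have nX' : nontrivial (~: X) by rewrite nontrivialC.
have tX' : tight (~: X) by rewrite tightC.
have [Ds1 D1] := IH _ (sm _ nX) (shrink_mc tX mcG nX).
have [Ds2 D2] := IH _ (sm _ nX') (shrink_mc tX' mcG nX').
by exists (Ds1 ++ Ds2); apply: TCD_cut D1 D2.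
Qed.

(** * Claw-free graphs *)

Section Removable.
Variable G : mgraph.
Hypotheses (mcG : matching_covered G) (cubG : cubic G).
Implicit Types (u v x y : vertex G) (e f : edge G) (M : {set edge G}).

(** A component of the graph without [e] that is not everything would have cut exactly [e], against
    [not_bridge]. *)
Lemma delete_connected e : connected (delete_edge e).
Proof.
apply/forallP=> u; apply/forallP=> w; apply: contraT => nuw.
pose A : {set vertex G} := [set x | connect (@adj (delete_edge e)) u x].
have uA : u \in A by rewrite inE connect0.
have wA : w \notin A by rewrite inE.
have adjA f x y : f != e -> ends f = [set x; y] -> x \in A -> y \in A.
  move=> fe E; rewrite !inE => ux; apply: connect_trans ux (connect1 _).
  by apply/existsP; exists (exist _ f fe : edge (delete_edge e)); apply/eqP.
have sub : cut A \subset [set e].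
  apply/subsetP=> f; rewrite inE; apply: contraLR => fe.
  have [x [y E]] := ends2 f; rewrite (mem_cut _ E).
  have E' : ends f = [set y; x] by rewrite setUC.
  apply/negP; case: (boolP (x \in A)) => [xA|xA] /=.
    by rewrite (adjA f x y).
  by move=> yA; rewrite (adjA f y x) in xA.
have A0 : A != set0 by apply/set0Pn; exists u.
have AT : A != setT by apply: contraNneq wA => ->.
case/set0Pn: (mc_cut mcG A0 AT) => f fC.
have /negP[] := not_bridge mcG cubG A e.
rewrite eqEsubset sub sub1set; move: (subsetP sub f fC); rewrite inE => /eqP fe.
by rewrite -fe.
Qed.

Lemma removable_avoidable e : removable e = avoidable e.
Proof.
apply/idP/avoidableP=> [/and3P[_ _ /forallP H] f fe|H].
  have /existsP[M /andP[pM fM]] := H (exist _ f fe : edge (delete_edge e)).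
  pose N : {set edge G} := [set val a | a : edge (delete_edge e) in M].
  exists N; split.
  - apply: pm_intro => v; have [a aM va] := @pm_cover (delete_edge e) M v pM.
    exists (val a); first by split; [apply: imset_f|].
    by move=> _ /imsetP[b bM ->] vb; congr val; apply: pm_uniq pM bM aM vb va.
  - by apply/imsetP; exists (exist _ f fe : edge (delete_edge e)).
  by apply/imsetP=> -[a _ ae]; have := valP a; rewrite -ae eqxx.
apply/and3P; split; first exact: delete_connected.
  by case/and3P: mcG.
apply/forallP=> f; have [M [pM fM eM]] := H (val f) (valP f).
apply/existsP; exists [set a : edge (delete_edge e) | val a \in M].
rewrite inE fM andbT; apply: pm_intro => v; have [a aM va] := @pm_cover G M v pM.
have ae : a != e by apply: contraNneq eM => <-.
exists (exist _ a ae : edge (delete_edge e)); first by rewrite inE.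
by move=> b; rewrite inE => bM vb; apply: val_inj; apply: pm_uniq pM bM aM vb va.
Qed.

Variables (M0 : {set edge G}) (bg : block_graph M0).
Hypothesis simG : simple G.

Lemma simple_inj e f : ends e = ends f -> e = f.
Proof. by move/injectiveP: simG; apply. Qed.

(** A matching missing an [M0]-edge cannot contain the opposite edge of a triangle at its end; at a
    chorded 4-cycle it misses some other [M0]-edge as well. Opposite edges of a 4-cycle lie in the
    same matchings, and a digon would contradict simplicity. *)
Lemma avoidable_ftriangle e : avoidable e -> ftriangle M0 e.
Proof.
move=> /avoidableP av; have [v [p0 E0]] := ends2 e; have ve := end1 E0.
case: (boolP (e \in M0)) => eM.
  have mv := mate_uniq bg eM ve.
  have [c1 [c2 [c12 c1M c2M vc1 vc2]]] := F_pair bg v; exfalso.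
  have [p E1 E2|p q c3 pq c3M E1 E2 E3|p q w c3 c4 h pq vw c3M c4M hM E1 E2 E3 E4 H] :=
    bg_block bg c12 c1M c2M vc1 vc2.
  - by case/eqP: c12; apply: simple_inj; rewrite E1.
  - have [|M [pM c3i ei]] := av c3; first by apply: contraNneq c3M => ->.
    have T : is_tri M0 v p q c1 c2 c3 by [].
    have [] := is_tri_pm bg T pM; rewrite mv (negPf ei) c3i.
    by case: (c1 \in M); case: (c2 \in M); case: (_ \in M); case: (_ \in M).
  have E1' : ends c1 = [set p; v] by rewrite setUC.
  have E2' : ends c2 = [set q; v] by rewrite setUC.
  have E3' : ends c3 = [set w; p] by rewrite setUC.
  have E4' : ends c4 = [set w; q] by rewrite setUC.
  have hh : mate bg v = mate bg w /\ mate bg p != e \/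
            mate bg p = mate bg q /\ mate bg p != e.
    case: H => hE; [left|right]; have := mate_uniq bg hM (end1 hE);
    have := mate_uniq bg hM (end2 hE) => h2 h1.
      split; first by rewrite h1 h2.
      rewrite -mv h1; apply: contraNneq (ends_neq E1) => ph.
      have := mate_end bg p; rewrite ph hE !inE => /orP[]/eqP pE.
        by rewrite pE.
      by have := ends_neq E3; rewrite pE eqxx.
    split; first by rewrite h1 h2.
    rewrite h1; apply/eqP=> he; have := ve; rewrite -he hE !inE => /orP[]/eqP vE.
      by have := ends_neq E1; rewrite vE eqxx.
    by have := ends_neq E2; rewrite vE eqxx.
  have pe : mate bg p != e by case: hh => -[].
  have [M [pM pi ei]] := av _ pe.
  move: (star_pm2 bg pM pq c1M c2M E1 E2) (star_pm2 bg pM vw c1M c3M E1' E3).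
  move: (star_pm2 bg pM vw c2M c4M E2' E4) (star_pm2 bg pM pq c3M c4M E3' E4').
  rewrite mv pi (negPf ei); case: hh => -[mm _].
    rewrite -mm mv (negPf ei); do 4!case: (_ \in M) => //; by case: (_ \in M).
  rewrite -mm pi; do 4!case: (_ \in M) => //; by case: (_ \in M).
have [c2 [c12 c2M vc2]] := F_other bg eM ve.
have [p E1 E2|p q c3 pq c3M E1 E2 E3|p q w c3 c4 h pq vw c3M c4M hM E1 E2 E3 E4 H] :=
  bg_block bg c12 eM c2M ve vc2.
- by case/eqP: c12; apply: simple_inj; rewrite E1.
- by apply/ftriangleP; exists v, p, q, c2, c3.
have [|M [pM]] := av c4.
  apply: contraNneq (ends_neq E2) => ce; have := end1 E1; rewrite -ce E4 !inE.
  by rewrite (negPf vw) orbF.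
by rewrite -(quad_pm bg pM pq vw eM c2M c3M c4M hM E1 E2 E3 E4 H) => ->.
Qed.

Lemma RE_solid : RE G = solid M0.
Proof.
apply/setP=> e; rewrite !in_set removable_avoidable.
by apply/idP/andP=> [ea|[]//]; split=> //; apply: avoidable_ftriangle.
Qed.

End Removable.

(** * The matching [M0] of a claw-free graph *)

Section ClawFree.
Variable G : mgraph.
Hypotheses (mcG : matching_covered G) (cubG : cubic G) (simG : simple G).
Implicit Types (u v w x y z a b : vertex G) (e f : edge G) (M : {set edge G}).

Definition nbr v : {set vertex G} := [set x | adj v x].

Lemma adjP x y : reflect (exists e, ends e = [set x; y]) (adj x y).
Proof. by apply: (iffP existsP) => -[e E]; exists e; apply/eqP. Qed.

Lemma adjC x y : adj x y = adj y x.
Proof. by apply/adjP/adjP=> -[e E]; exists e; rewrite setUC. Qed.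

Lemma adj_neq x y : adj x y -> x != y.
Proof. by case/adjP=> e /ends_neq. Qed.

Lemma card_nbr v : #|nbr v| = 3.
Proof.
rewrite -(incident3 cubG v) -(card_imset (mem (incident v)) (simple_inj simG)).
rewrite -(card_in_imset (f := fun x => [set v; x])) => [|x y]; last first.
  rewrite !inE => /adjP[e E] _ E'; rewrite E' in E.
  apply: (ends_inj (e := e) _ E); by rewrite E E'.
apply: eq_card => A; apply/imsetP/imsetP=> [[x]|[e]].
  by rewrite inE => /adjP[e E] ->; exists e; rewrite ?inE ?E ?set21.
rewrite inE => ve ->; have [x _ E] := endsP ve; exists x => //.
by rewrite inE; apply/adjP; exists e.
Qed.

Lemma nbr3 v x y z : adj v x -> adj v y -> adj v z -> x != y -> x != z -> y != z ->
  nbr v = [set x; y; z].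
Proof.
move=> vx vy vz xy xz yz; apply/esym/eqP; rewrite eqEcard card_nbr.
rewrite -setUA cardsU1 cards2 !inE negb_or xy xz yz andbT.
by rewrite !subUset !sub1set !inE vx vy vz.
Qed.

(** The number of triangles on [e]. Away from K_4 it is 1 on the edges of F, 0 on an edge in no
    triangle and 2 on the central edge of a diamond. *)
Definition codeg e := #|[set x | [forall y in ends e, adj y x]]|.

Lemma codegE e v w a b : ends e = [set v; w] -> adj v a -> adj v b ->
  w != a -> w != b -> a != b -> codeg e = adj w a + adj w b.
Proof.
move=> E va vb wa wb ab; have vw : adj v w by apply/adjP; exists e.
have N := nbr3 vw va vb wa wb ab.
rewrite /codeg -sum1_card (eq_bigl (fun x => (x \in nbr v) && adj w x)) => [|x].
  rewrite big_mkcondr N -setUA !big_setU1 ?inE ?negb_or ?wa ?wb ?ab //= big_set1.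
  have -> : adj w w = false by apply/negbTE/negP=> /adj_neq; rewrite eqxx.
  by case: (adj w a); case: (adj w b).
rewrite !inE; apply/forall_inP/andP=> [H|[vx wx] y].
  by split; apply: H; rewrite E ?set21 ?set22.
by rewrite E => /set2P[]->.
Qed.

Hypothesis cfG : claw_free G.

Lemma no_claw v x y z : adj v x -> adj v y -> adj v z ->
  x != y -> x != z -> y != z -> [|| adj x y, adj x z | adj y z].
Proof.
move=> vx vy vz xy xz yz; apply: contraT; rewrite !negb_or => /and3P[nxy nxz nyz].
case/negP: cfG; pose s := [:: v; x; y; z].
apply/existsP; exists [ffun i : 'I_4 => nth v s i].
have us : uniq s by rewrite /= !inE !negb_or xy xz yz !adj_neq.
have irr u : adj u u = false by apply/negbTE/negP=> /adj_neq; rewrite eqxx.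
apply/andP; split.
  by apply/injectiveP=> i j; rewrite !ffunE => /eqP; rewrite nth_uniq // => /eqP/val_inj.
apply/forallP=> i; apply/forallP=> j; rewrite !ffunE.
by case: i => [[|[|[|[|//]]]] ?]; case: j => [[|[|[|[|//]]]] ?] /=;
  rewrite /K13 /= ?irr // 1?[adj _ v]adjC ?vx ?vy ?vz // 1?adjC ?(negPf nxy) ?(negPf nxz) ?(negPf nyz) //
    1?adjC ?(negPf nxy) ?(negPf nxz) ?(negPf nyz).
Qed.

Lemma nbr_labels v : exists x y z,
  [/\ adj v x, adj v y & adj v z] /\ [/\ x != y, x != z, y != z & adj x y] /\
  (adj x z -> adj y z).
Proof.
have /card_gt2P[x [y [z [[]]]]] : 2 < #|nbr v| by rewrite card_nbr.
rewrite !inE => vx vy vz [xy yz zx]; have xz : x != z by rewrite eq_sym.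
have yx : y != x by rewrite eq_sym.
have zy : z != y by rewrite eq_sym.
case: (boolP (adj x y)) => axy; last first.
  case: (boolP (adj y z)) => ayz.
    by exists y, z, x; do 2!split=> //; rewrite [adj y x]adjC (negPf axy).
  have := no_claw vx vy vz xy xz yz; rewrite (negPf ayz) (negPf axy) orbF => axz.
  by exists x, z, y; do 2!split=> //; rewrite (negPf axy).
case: (boolP (adj x z)) => axz; last first.
  by exists x, y, z; do 2!split=> //; rewrite (negPf axz).
case: (boolP (adj y z)) => ayz; first by exists x, y, z.
by exists y, x, z; do 2!split=> //; rewrite adjC.
Qed.

(** Removing a perfect matching from K_4 leaves a 4-cycle, of which the matching edge at [v] is a
    chord. *)
Lemma pm_blocks_K4 M : perfect_matching M -> (forall x y, x != y -> adj x y) ->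
  block_graph M.
Proof.
move=> pM full; split=> // v c1 c2 c12 c1M c2M vc1 vc2.
have [p vp E1] := endsP vc1; have [q vq E2] := endsP vc2.
have pq : p != q by apply: contra c12 => /eqP pq; apply/eqP/(simple_inj simG); rewrite E1 E2 pq.
have [g gM vg] := pm_cover v pM; have [w vw E] := endsP vg.
have cw c x : c \notin M -> ends c = [set v; x] -> x != w.
  move=> cM Ec; apply: contra cM => /eqP xw.
  by rewrite (simple_inj simG (_ : ends c = ends g)) // Ec E xw.
have [pw qw] := (cw _ _ c1M E1, cw _ _ c2M E2).
have /adjP[c3 E3] := full _ _ pw; have /adjP[c4 E4] := full _ _ qw.
have wM c x : v != x -> x != w -> ends c = [set x; w] -> c \notin M.
  move=> vx xw Ec; apply/negP=> cM.
  have cg := pm_uniq pM cM gM (end2 Ec) (end2 E).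
  by have := end1 Ec; rewrite cg E !inE eq_sym (negPf vx) (negPf xw).
apply: (@Quad _ _ _ _ _ p q w c3 c4 g) => //; last by left.
  exact: wM vp pw E3.
exact: wM vq qw E4.
Qed.

Lemma codeg_blocks :
  (forall v x y z, adj v x -> adj v y -> adj v z -> x != y -> x != z -> y != z ->
     adj x y -> adj x z -> adj y z -> False) ->
  block_graph [set e | codeg e != 1].
Proof.
move=> nK4; set M := [set e | _].
have labels v : exists x y z ex ey ez,
    [/\ ends ex = [set v; x], ends ey = [set v; y] & ends ez = [set v; z]] /\
    [/\ x != y, x != z, y != z & adj x y] /\ adj x z = false.
  have [x [y [z [[vx vy vz] [[xy xz yz axy] axz]]]]] := nbr_labels v.
  have /adjP[ex Ex] := vx; have /adjP[ey Ey] := vy; have /adjP[ez Ez] := vz.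
  exists x, y, z, ex, ey, ez; do 2!split=> //; apply/negbTE/negP=> h.
  exact: nK4 vx vy vz xy xz yz axy h (axz h).
have inc v x y z ex ey ez e : ends ex = [set v; x] -> ends ey = [set v; y] ->
    ends ez = [set v; z] -> x != y -> x != z -> y != z -> v \in ends e ->
    [\/ e = ex, e = ey | e = ez].
  move=> Ex Ey Ez xy xz yz ve; have [w _ E] := endsP ve.
  have : w \in nbr v by rewrite inE; apply/adjP; exists e.
  rewrite (@nbr3 v x y z) //; [|by apply/adjP; exists ex|by apply/adjP; exists ey|by apply/adjP; exists ez].
  rewrite !inE -orbA => /or3P[]/eqP wE; [constructor 1|constructor 2|constructor 3];
    by apply: (simple_inj simG); rewrite E wE.
have deg v x y z ex ey ez : ends ex = [set v; x] -> ends ey = [set v; y] ->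
    ends ez = [set v; z] -> x != y -> x != z -> y != z ->
    [/\ (ex \in M) = (adj x y + adj x z != 1), (ey \in M) = (adj x y + adj y z != 1)
      & (ez \in M) = (adj x z + adj y z != 1)].
  move=> Ex Ey Ez xy xz yz.
  have [vx vy vz] : [/\ adj v x, adj v y & adj v z].
    by split; apply/adjP; [exists ex|exists ey|exists ez].
  have [yx zx zy] : [/\ y != x, z != x & z != y] by split; rewrite eq_sym.
  rewrite !inE (codegE Ex vy vz) // (codegE Ey vx vz) // (codegE Ez vx vy) //.
  by rewrite [adj y x]adjC [adj z x]adjC [adj z y]adjC.
split=> //.
  apply: pm_intro => v.
  have [x [y [z [ex [ey [ez [[Ex Ey Ez] [[xy xz yz axy] axz]]]]]]]] := labels v.
  have [dx dy dz] := deg _ _ _ _ _ _ _ Ex Ey Ez xy xz yz.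
  rewrite axy axz in dx dy dz; case ayz: (adj y z) in dy dz.
    exists ey; first by rewrite dy (end1 Ey).
    by move=> e eM ve; case: (inc _ _ _ _ _ _ _ e Ex Ey Ez xy xz yz ve) => eE //;
      rewrite eE ?dx ?dz in eM.
  exists ez; first by rewrite dz (end1 Ez).
  by move=> e eM ve; case: (inc _ _ _ _ _ _ _ e Ex Ey Ez xy xz yz ve) => eE //;
    rewrite eE ?dx ?dy in eM.
have sym_block v c1 c2 : block M v c1 c2 -> block M v c2 c1.
  case=> [p E1 E2|p q c3 pq c3M E1 E2 E3|p q w c3 c4 h pq vw c3M c4M hM E1 E2 E3 E4 H].
  - exact: Digon E2 E1.
  - apply: (Triangle _ c3M E2 E1); first by rewrite eq_sym.
    by rewrite setUC.
  apply: (Quad _ vw c4M c3M hM E2 E1 E4 E3); first by rewrite eq_sym.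
  by rewrite [[set q; p]]setUC.
move=> v c1 c2 c12 c1M c2M vc1 vc2.
have [x [y [z [ex [ey [ez [[Ex Ey Ez] [[xy xz yz axy] axz]]]]]]]] := labels v.
have [dx dy dz] := deg _ _ _ _ _ _ _ Ex Ey Ez xy xz yz.
have [yx zx zy] : [/\ y != x, z != x & z != y] by split; rewrite eq_sym.
have [vx vy vz] : [/\ adj v x, adj v y & adj v z].
  by split; apply/adjP; [exists ex|exists ey|exists ez].
have [xv yv zv] : [/\ adj x v, adj y v & adj z v] by split; rewrite adjC.
have [vx' vy'] := (adj_neq vx, adj_neq vy).
have nedge e a b d : ends e = [set a; b] -> adj a v -> adj a d -> b != v ->
    b != d -> v != d -> adj b v -> adj b d = false -> e \notin M.
  move=> E av ad bv bd vd abv abd.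
  by rewrite inE negbK (codegE E av ad) // abv abd.
have /adjP[c3 E3] := axy.
rewrite axy axz in dx dy dz; case ayz: (adj y z) in dy dz.
  (* Here vy is the central edge of a diamond, so it is the chord of the 4-cycle v, x, y, z. *)
  have blk : block M v ex ez.
    have /adjP[c4 E4] : adj z y by rewrite adjC.
    have ey1 : ey \in M by rewrite dy.
    apply: (@Quad _ _ _ _ _ x z y c3 c4 ey) => //; last by left.
    - have E3' : ends c3 = [set y; x] by rewrite setUC.
      by apply: (nedge _ _ _ z E3') => //; rewrite 1?eq_sym ?adj_neq.
    - have E4' : ends c4 = [set y; z] by rewrite setUC.
      have ayx : adj y x by rewrite adjC.
      by apply: (nedge _ _ _ x E4') => //; rewrite 1?eq_sym ?adj_neq // adjC.
  have pick c : c \notin M -> v \in ends c -> c = ex \/ c = ez.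
    move=> cM vc; case: (inc _ _ _ _ _ _ _ c Ex Ey Ez xy xz yz vc) => cE; [by left| |by right].
    by rewrite cE dy in cM.
  have [c1E|c1E] := pick _ c1M vc1; have [c2E|c2E] := pick _ c2M vc2;
    rewrite c1E c2E ?eqxx // in c12 *.
  exact: sym_block.
(* Here vz lies in no triangle. Either xy lies only in vxy, which is then an F-triangle, or xy is
   the central edge of a diamond with a further vertex [w], and is the chord of v, x, w, y. *)
have blk : block M v ex ey.
  case: (boolP (c3 \in M)) => c3M; last exact: (Triangle xy c3M Ex Ey E3).
  have /card_gt0P[w] : 0 < #|nbr x :\: [set v; y]|.
    rewrite cardsDS ?card_nbr ?cards2 ?vy' //.
    by apply/subsetP=> a /set2P[]->; rewrite inE.
  rewrite !inE negb_or => /andP[/andP[wv wy] xw].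
  have yw : adj y w.
    have vw : v != w by rewrite eq_sym.
    have yw : y != w by rewrite eq_sym.
    have yv' : y != v by rewrite eq_sym.
    by move: c3M; rewrite inE (codegE E3 xv xw) // yv; case: (adj y w).
  have vw : v != w by rewrite eq_sym.
  have wz : w != z by apply: contraTneq xw => ->; rewrite axz.
  have wx : w != x by rewrite eq_sym adj_neq.
  have vwn : adj w v = false.
    apply/negbTE/negP; rewrite adjC => aw; have : w \in nbr v by rewrite inE.
    by rewrite (nbr3 vx vy vz xy xz yz) !inE (negPf wx) (negPf wy) (negPf wz).
  have /adjP[c4 E4] := xw; have /adjP[c5 E5] := yw.
  have F c a d : ends c = [set a; w] -> adj a v -> adj a d -> w != d -> v != d ->
      adj w d -> c \notin M.
    by move=> E av ad wd vd awd; rewrite inE negbK (codegE E av ad) // vwn awd.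
  apply: (@Quad _ _ _ _ _ x y w c4 c5 c3) => //; last by right.
    by apply: (F _ _ y E4); rewrite // adjC.
  by apply: (F _ _ x E5); rewrite // adjC.
have pick c : c \notin M -> v \in ends c -> c = ex \/ c = ey.
  move=> cM vc; case: (inc _ _ _ _ _ _ _ c Ex Ey Ez xy xz yz vc) => cE; [by left|by right|].
  by rewrite cE dz in cM.
have [c1E|c1E] := pick _ c1M vc1; have [c2E|c2E] := pick _ c2M vc2;
  rewrite c1E c2E ?eqxx // in c12 *.
exact: sym_block.
Qed.

(** K_4 is set apart because each of its edges has [codeg] 2, so the codegree rule would select all
    of them. In a connected cubic graph it is the whole graph, and any perfect matching serves. *)
Lemma claw_free_block_graph : exists M, block_graph M.
Proof.
case: (boolP [exists v : vertex G, exists x, exists y, exists z,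
  [&& adj v x, adj v y, adj v z, x != y, x != z, y != z, adj x y, adj x z & adj y z]]).
  case/existsP=> v /existsP[x /existsP[y /existsP[z]]].
  case/and5P=> vx vy vz xy /and5P[xz yz axy axz ayz].
  pose Y := [set v; x; y; z].
  have [ax ay az] : [/\ adj x v, adj y v & adj z v] by split; rewrite adjC.
  have [nvx nvy nvz] := And3 (adj_neq vx) (adj_neq vy) (adj_neq vz).
  have Nv := nbr3 vx vy vz xy xz yz.
  have Nx := nbr3 ax axy axz nvy nvz yz.
  have Ny : nbr y = [set v; x; z] by apply: nbr3; rewrite // adjC.
  have Nz : nbr z = [set v; x; y] by apply: nbr3; rewrite // adjC.
  have full a b : a \in Y -> adj a b = (b \in Y) && (a != b).
    have -> : adj a b = (b \in nbr a) by rewrite in_set.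
    move=> aY.
    have [->|->|->|->] : [\/ a = v, a = x, a = y | a = z].
      by move: aY; rewrite !inE -!orbA => /or4P[]/eqP; 
        [constructor 1|constructor 2|constructor 3|constructor 4].
    - rewrite Nv !inE; case: (eqVneq b v) => [->|_];
      last by rewrite ?orbF ?andbT ?orbA.
      by rewrite ?(eq_sym x v) ?(eq_sym y v) ?(eq_sym z v) ?(eq_sym y x)
        ?(eq_sym z x) ?(eq_sym z y) ?(negPf nvx) ?(negPf nvy) ?(negPf nvz)
        ?(negPf xy) ?(negPf xz) ?(negPf yz) ?andbF.
    - rewrite Nx !inE; case: (eqVneq b x) => [->|_];
      last by rewrite ?orbF ?andbT ?orbA.
      by rewrite ?(eq_sym x v) ?(eq_sym y v) ?(eq_sym z v) ?(eq_sym y x)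
        ?(eq_sym z x) ?(eq_sym z y) ?(negPf nvx) ?(negPf nvy) ?(negPf nvz)
        ?(negPf xy) ?(negPf xz) ?(negPf yz) ?andbF.
    - rewrite Ny !inE; case: (eqVneq b y) => [->|_];
      last by rewrite ?orbF ?andbT ?orbA.
      by rewrite ?(eq_sym x v) ?(eq_sym y v) ?(eq_sym z v) ?(eq_sym y x)
        ?(eq_sym z x) ?(eq_sym z y) ?(negPf nvx) ?(negPf nvy) ?(negPf nvz)
        ?(negPf xy) ?(negPf xz) ?(negPf yz) ?andbF.
    - rewrite Nz !inE; case: (eqVneq b z) => [->|_];
      last by rewrite ?orbF ?andbT ?orbA.
      by rewrite ?(eq_sym x v) ?(eq_sym y v) ?(eq_sym z v) ?(eq_sym y x)
        ?(eq_sym z x) ?(eq_sym z y) ?(negPf nvx) ?(negPf nvy) ?(negPf nvz)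
        ?(negPf xy) ?(negPf xz) ?(negPf yz) ?andbF.
  have YT : Y = setT.
    apply/eqP; apply: contraT => YT.
    have Y0 : Y != set0 by apply/set0Pn; exists v; rewrite !inE eqxx.
    have /set0Pn[e] := mc_cut mcG Y0 YT; have [a [b E]] := ends2 e.
    rewrite (mem_cut _ E); have ab : adj a b by apply/adjP; exists e.
    case: (boolP (a \in Y)) => aY /= bY; first by move: ab; rewrite full // (negPf bY).
    by move: ab; rewrite adjC full // (negPf aY).
  have /adjP[e _] := vx; have [M pM _] := mc_edge mcG e; exists M.
  by apply: pm_blocks_K4 => // a b ab; rewrite full YT ?inE.
move=> none; exists [set e | codeg e != 1]; apply: codeg_blocks => v x y z.
move=> vx vy vz xy xz yz axy axz ayz; case/negP: none.
apply/existsP; exists v; apply/existsP; exists x; apply/existsP; exists y.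
by apply/existsP; exists z; rewrite vx vy vz xy xz yz axy axz ayz.
Qed.

End ClawFree.

(** * The truncation of K_4 *)

(* Vertex 3t + j lies in the triangle replacing the vertex t of K_4. *)
Section TruncatedK4.

Definition tk4_edges : seq (nat * nat) :=
  [:: (0, 1); (0, 2); (1, 2); (3, 4); (3, 5); (4, 5); (6, 7); (6, 8); (7, 8);
      (9, 10); (9, 11); (10, 11);
      (0, 3); (1, 6); (2, 9); (4, 7); (5, 10); (8, 11)].

(** Incidence is put on natural numbers so that the finite checks become computations over [iota];
    the 18 edge indices never reach the default of [nth]. *)
Definition tk4_inc (v e : nat) : bool :=
  let p := nth (0, 0) tk4_edges e in (v == p.1) || (v == p.2).

Definition tk4_ends (e : 'I_18) : {set 'I_12} := [set v : 'I_12 | tk4_inc v e].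

Lemma card_ord_nat n (p : pred nat) : #|[set i : 'I_n | p i]| = count p (iota 0 n).
Proof.
rewrite -sum1_card -sum1_count.
transitivity (\sum_(0 <= i < n | p i) 1); last by rewrite /index_iota subn0.
by rewrite big_mkord; apply: eq_bigl => i; rewrite inE.
Qed.

Lemma all_ord n (p : pred nat) : all p (iota 0 n) -> forall i : 'I_n, p i.
Proof. by move=> /allP H i; apply: H; rewrite mem_iota ltn_ord. Qed.

Lemma tk4_card2 e : #|tk4_ends e| == 2.
Proof.
rewrite /tk4_ends (card_ord_nat 12 (fun v => tk4_inc v e)).
exact: (@all_ord 18 (fun e => count (fun v => tk4_inc v e) (iota 0 12) == 2)).
Qed.

Definition tk4 : mgraph := MGraph tk4_card2.

Definition tk4_adj (x y : nat) : bool :=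
  (x != y) && has (fun e => tk4_inc x e && tk4_inc y e) (iota 0 18).

Lemma tk4_endsE (e : edge tk4) (v : vertex tk4) : (v \in ends e) = tk4_inc v e.
Proof. by rewrite inE. Qed.

Lemma tk4_adjE (x y : vertex tk4) : adj x y = tk4_adj x y.
Proof.
apply/adjP/andP=> [[e E]|[xy /hasP[e]]].
  split; first exact: ends_neq E.
  apply/hasP; exists (val e); first by rewrite mem_iota ltn_ord.
  by rewrite -!tk4_endsE E set21 set22.
rewrite mem_iota /= => e18 /andP[xe ye]; exists (Ordinal e18 : edge tk4).
by apply: (@ends_eq tk4); rewrite ?tk4_endsE.
Qed.

Lemma tk4_simple : simple tk4.
Proof.
apply/injectiveP=> e f ef; apply/val_inj/eqP.
have H : all (fun e => all (fun f =>
    all (fun v => tk4_inc v e == tk4_inc v f) (iota 0 12) ==> (e == f))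
    (iota 0 18)) (iota 0 18) by [].
have := all_ord (all_ord H e) f; move/implyP; apply.
apply/allP=> v; rewrite mem_iota /= => v12.
by rewrite -!(tk4_endsE _ (Ordinal v12 : vertex tk4)) ef.
Qed.

Lemma tk4_cubic : cubic tk4.
Proof.
apply/forallP=> v; have -> : incident v = [set e : 'I_18 | tk4_inc v e].
  by apply/setP=> e; rewrite !in_set.
rewrite (card_ord_nat 18 (tk4_inc v)).
exact: (@all_ord 12 (fun v => count (tk4_inc v) (iota 0 18) == 3)).
Qed.

Lemma tk4_no_claw (v x y z : 'I_12) : tk4_adj v x -> tk4_adj v y -> tk4_adj v z ->
  [|| x == y :> nat, x == z :> nat, y == z :> nat, tk4_adj x y, tk4_adj x z
    | tk4_adj y z].
Proof.
have chk : all (fun v => all (fun x => tk4_adj v x ==> all (fun y => tk4_adj v y ==>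
    all (fun z => tk4_adj v z ==>
      [|| x == y, x == z, y == z, tk4_adj x y, tk4_adj x z | tk4_adj y z])
    (iota 0 12)) (iota 0 12)) (iota 0 12)) (iota 0 12) by vm_compute.
move=> vx vy vz; have /implyP/(_ vx) {}chk := all_ord (all_ord chk v) x.
have /implyP/(_ vy) {}chk := all_ord chk y.
by have /implyP/(_ vz) := all_ord chk z.
Qed.

Lemma tk4_claw_free : claw_free tk4.
Proof.
apply/negP=> /existsP[f /andP[/injectiveP fI /forallP H]].
have fadj i j : tk4_adj (f i) (f j) = K13 i j.
  by rewrite -tk4_adjE; have /forallP/(_ j)/eqP := H i.
pose i1 : 'I_4 := @Ordinal 4 1 isT; pose i2 : 'I_4 := @Ordinal 4 2 isT.
pose i3 : 'I_4 := @Ordinal 4 3 isT.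
have fne (i j : 'I_4) : i != j -> (f i == f j :> nat) = false.
  by move=> ij; apply/negbTE; apply: contra ij => /eqP/val_inj/fI->.
have := @tk4_no_claw (f ord0) (f i1) (f i2) (f i3).
by rewrite !fadj !fne // => /(_ isT isT isT).
Qed.

(** Each is the complement of a cycle of K_4 among the six linking edges, completed inside the
    triangles: all four triangles and two of the three 4-cycles occur. Every edge is covered, and
    only the first list contains edge 0, whose other members recur later. *)
Definition tk4_matchings : seq (seq nat) :=
  [:: [:: 0; 14; 3; 16; 6; 17]; [:: 1; 13; 3; 16; 8; 10]; [:: 1; 13; 4; 15; 17; 9];
      [:: 12; 2; 5; 6; 17; 9]; [:: 12; 2; 15; 16; 7; 10]; [:: 12; 13; 14; 5; 8; 11]].

Definition tk4_pm (l : seq nat) : {set edge tk4} := [set e : 'I_18 | val e \in l].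

Lemma tk4_pmP l : l \in tk4_matchings -> perfect_matching (tk4_pm l).
Proof.
have chk : all (fun l => all (fun v =>
    count (fun e => (e \in l) && tk4_inc v e) (iota 0 18) == 1) (iota 0 12))
  tk4_matchings by vm_compute.
move=> /(allP chk) lM; apply/forallP=> v.
have -> : tk4_pm l :&: incident v =
    [set e : 'I_18 | (fun e => (e \in l) && tk4_inc v e) (val e)].
  by apply/setP=> e; rewrite in_setI [_ \in incident v]in_set [_ \in tk4_pm l]in_set
    [RHS]in_set tk4_endsE.
rewrite (card_ord_nat 18 (fun e => (e \in l) && tk4_inc v e)).
exact: (all_ord lM).
Qed.

Lemma tk4_mc : matching_covered tk4.
Proof.
apply/and3P; split; last 2 first.
- by rewrite card_ord.
- have chk : all (fun e => has (fun l => e \in l) tk4_matchings) (iota 0 18) by [].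
  apply/forallP=> e; have /hasP[l lM el] := all_ord chk e.
  by apply/existsP; exists (tk4_pm l); rewrite tk4_pmP // in_set.
have sym : connect_sym (@adj tk4).
  by apply: sym_connect_sym => x y; apply: adjC.
(* Each vertex but 0 has a neighbour of smaller index, so descent reaches 0. *)
have chk : all (fun v => (v == 0) || has (fun u => tk4_adj u v) (iota 0 v)) (iota 0 12) by [].
have c0 (v : vertex tk4) : connect (@adj tk4) (ord0 : 'I_12) v.
  have [n] := ubnP (val v); elim: n v => // n IH v vn.
  have := all_ord chk v; case/orP=> [/eqP v0|/hasP[u]].
    by have -> : v = ord0 by [apply: val_inj]; apply: connect0.
  rewrite mem_iota /= add0n => uv uva.
  have u12 : u < 12 by apply: ltn_trans uv (ltn_ord v).
  apply: connect_trans (IH (Ordinal u12) _) (connect1 _).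
    by rewrite /=; apply: leq_trans uv _; rewrite -ltnS.
  by rewrite tk4_adjE.
apply/forallP=> u; apply/forallP=> v; apply: connect_trans (c0 v).
by rewrite sym; apply: c0.
Qed.

Lemma tk4_removable : removable ((ord0 : 'I_18) : edge tk4).
Proof.
rewrite (removable_avoidable tk4_mc tk4_cubic); apply/avoidableP=> f f0.
have chk : all (fun e => (e == 0) || has (fun l => (e \in l) && (0 \notin l)) tk4_matchings)
  (iota 0 18) by [].
have := all_ord chk f; case/orP=> [/eqP fE|/hasP[l lM /andP[fl l0]]].
  by case/eqP: f0; apply: val_inj.
exists (tk4_pm l).
by rewrite tk4_pmP //; split=> //; rewrite in_set.
Qed.

End TruncatedK4.

(** * Removable edges of the whole graph, and sharpness *)

Lemma claw_free_RE (G : mgraph) :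
  simple G -> cubic G -> claw_free G -> matching_covered G ->
  ~~ minimal_matching_covered G ->
  (forall Ds, tight_cut_decomposition G Ds ->
     1 <= bstar Ds /\ #|RE G| = \sum_(B <- star_bricks Ds) #|vertex B|) /\
  12 <= #|RE G| <= #|vertex G|.
Proof.
move=> simG cubG cfG mcG; rewrite /minimal_matching_covered mcG /= => RE0.
have [M0 bg] := claw_free_block_graph mcG cubG simG cfG.
have RE_S := RE_solid mcG cubG bg simG; rewrite RE_S in RE0 *.
rewrite -card_gt0 in RE0; split=> [Ds /(decomposition_solid bg)[S H]|].
  by case: (H RE0).
have [Ds /(decomposition_solid bg)[_ /(_ RE0)[_ ->]]] := decomposition_exists mcG.
by rewrite -(card_F bg) subset_leq_card ?solid_sub_F.
Qed.

Theorem theorem1p3 :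
  (forall G : mgraph,
     simple G -> cubic G -> claw_free G -> matching_covered G ->
     ~~ minimal_matching_covered G ->
     ((exists Ds, tight_cut_decomposition G Ds) /\
      (forall Ds, tight_cut_decomposition G Ds ->
         1 <= bstar Ds /\
         #|RE G| = \sum_(B <- star_bricks Ds) #|vertex B|)) /\
     12 <= #|RE G|) /\
  (exists G : mgraph,
     [/\ simple G, cubic G, claw_free G & matching_covered G] /\
     ~~ minimal_matching_covered G /\ #|RE G| = 12).
Proof.
split=> [G simG cubG cfG mcG nmin|].
  have [dec /andP[ge12 _]] := claw_free_RE simG cubG cfG mcG nmin.
  by do 2!split=> //; apply: decomposition_exists.
exists tk4; split; first split.
- exact: tk4_simple.
- exact: tk4_cubic.
- exact: tk4_claw_free.
- exact: tk4_mc.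
have nmin : ~~ minimal_matching_covered tk4.
  rewrite /minimal_matching_covered tk4_mc /=; apply/set0Pn.
  by exists (ord0 : 'I_18); rewrite in_set tk4_removable.
(* The lower and the upper bound of [claw_free_RE] coincide, as [tk4] has twelve vertices. *)
split=> //; have [_] := claw_free_RE tk4_simple tk4_cubic tk4_claw_free tk4_mc nmin.
by rewrite card_ord -eqn_leq => /eqP.
Qed.
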